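(* Let $(\mathcal{X},\mathcal{Y}_1,\mathcal{Y}_2,\mathcal{Z},P_{Y_1,Y_2,Z|X})$ be a discrete memoryless two-user broadcast channel with a warden, with $\mathcal{X}=\{0,1,\ldots,K\}$, $Q_x:=P_{Z|X}(\cdot|x)$, $\operatorname{supp}(Q_0)=\mathcal{Z}$, and the no-input symbol $0$ not redundant, i.e. $Q_0\notin\mathrm{conv}\{Q_{x'}: x'\in\mathcal{X}, x'\neq 0\}$. Let $W:=P_{Y_1|X}$ and $V:=P_{Y_2|X}$, and assume $W(\cdot|k)\ll W(\cdot|0)$ and $V(\cdot|k)\ll V(\cdot|0)$ for all $k\in\mathcal{X}\setminus\{0\}$. Let $L_1^*:=L^*(P_{Y_1,Z|X})$ and $L_2^*:=L^*(P_{Y_2,Z|X})$, and assume the following condition: if $L_1^*\ge L_2^*$ then $\max_{P_X} \frac{I(X;Y_1)}{I(X;Y_2)}\le \frac{L_1^*}{L_2^*}$, and otherwise (if $L_2^*\ge L_1^*$) $\max_{P_X}\frac{I(X;Y_2)}{I(X;Y_1)}\le \frac{L_2^*}{L_1^*}$. Assume the secret key may be arbitrarily long. Then for every $\delta>0$ the $\delta$-covert capacity region is $$\mathcal{L}_\delta=\left\{(L_1,L_2)\in\mathbb{R}_+^2:\ \frac{L_1}{L_1^*}+\frac{L_2}{L_2^*}\le 1\right\}.$$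
   Context: A discrete memoryless two-user broadcast channel (BC) with a warden consists of finite alphabets $\mathcal{X},\mathcal{Y}_1,\mathcal{Y}_2,\mathcal{Z}$ and a transition matrix $P_{Y_1,Y_2,Z|X}$, used $n$ times memorylessly; $\mathcal{Y}_1,\mathcal{Y}_2$ are the legitimate receivers and $\mathcal{Z}$ the warden. Symbol $0\in\mathcal{X}$ is the ''no-input'' symbol; if no communication takes place the warden observes $Z^n\sim Q_0^{\times n}$. An $(n,M_{1n},M_{2n},K_n,\varepsilon,\delta)$-code consists of independent messages $W_j$ uniform on $\{1,\ldots,M_{jn}\}$ ($j=1,2$), a secret key $S$ uniform on $\{1,\ldots,K_n\}$ independent of the messages and shared by the transmitter and both receivers, an encoder $f:\{1..M_{1n}\}\times\{1..M_{2n}\}\times\{1..K_n\}\to\mathcal{X}^n$, and decoders $\varphi_j:\mathcal{Y}_j^n\times\{1..K_n\}\to\{1..M_{jn}\}$, such that $\Pr(\cup_{j=1}^2\{\hat W_j\ne W_j\})\le\varepsilon$ and $D(\hat Q_{Z^n}\|Q_0^{\times n})\le\delta$, where $\hat Q_{Z^n}$ is the warden's output distribution induced by the code and $D$ is relative entropy. With arbitrarily large key sets allowed, $(L_1,L_2)\in\mathbb{R}_+^2$ is $(\varepsilon,\delta)$-achievable if there is a sequence of such codes with error $\varepsilon_n$ and covertness $\delta$ such that $\liminf_{n\to\infty}\frac{1}{\sqrt{n\delta}}\log M_{jn}\ge L_j$ for $j=1,2$ and $\limsup_n\varepsilon_n\le\varepsilon$. $\mathcal{L}_{\varepsilon,\delta}$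 is the closure of the set of $(\varepsilon,\delta)$-achievable pairs, and the $\delta$-covert capacity region is $\mathcal{L}_\delta:=\bigcap_{\varepsilon\in(0,1)}\mathcal{L}_{\varepsilon,\delta}$. For a point-to-point channel with a warden $P_{Y,Z|X}$ with $\mathcal{X}=\{0,\ldots,K\}$, $W':=P_{Y|X}$ and $Q_k:=P_{Z|X}(\cdot|k)$, its covert capacity is $L^*(P_{Y,Z|X}):=\max_{\mathbf p}\sqrt{\frac{2\left(\sum_{k=1}^K p_k D(W'(\cdot|k)\|W'(\cdot|0))\right)^2}{\chi_2\left(\sum_{k=1}^K p_kQ_k\,\middle\|\,Q_0\right)}}$, maximized over probability vectors $\mathbf p=(p_1,\ldots,p_K)$, where $\chi_2(Q_1\|Q_0):=\sum_z (Q_1(z)-Q_0(z))^2/Q_0(z)$. Logarithms are to an arbitrary fixed base. In the condition, the maxima are over input distributions $P_X$ on $\mathcal{X}$, with $(X,Y_1,Y_2)\sim P_X\times P_{Y_1,Y_2|X}$.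
   Formalization: Logarithms are natural (with another base b also used in the covertness divergence, the true region is off by a factor √(ln b)), and L₁*, L₂* are assumed positive so that the ratios L_j/L_j* and L₁*/L₂* are defined. *)

(* Defs.v *)
From HB Require Import structures.
From mathcomp Require Import all_boot all_order all_algebra.
From mathcomp Require Import all_classical all_reals all_analysis.
Set Implicit Arguments. Unset Strict Implicit. Unset Printing Implicit Defensive.
Import Order.TTheory GRing.Theory Num.Theory.
Import numFieldNormedType.Exports.
Local Open Scope ring_scope.
Local Open Scope classical_set_scope.

Section Defs.
Variable R : realType.

(* relative entropy D(p||q) with the convention 0 log(0/q) = 0 (natural log) *)
Definition KL (T : finType) (p q : T -> R) : R :=
  \sum_(t | p t != 0) p t * ln (p t / q t).

Definition chi2 (T : finType) (q1 q0 : T -> R) : R :=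
  \sum_t (q1 t - q0 t) ^+ 2 / q0 t.

Definition is_pmf (T : finType) (p : T -> R) : Prop :=
  (forall t, 0 <= p t) /\ \sum_t p t = 1.

Variables (K : nat) (Y1 Y2 Z : finType).
(* input alphabet X = {0,...,K} = 'I_K.+1, no-input symbol 0 = ord0 *)
Notation X := 'I_K.+1.

Definition is_channel (P : X -> Y1 -> Y2 -> Z -> R) : Prop :=
  forall x, (forall y1 y2 z, 0 <= P x y1 y2 z) /\
            \sum_y1 \sum_y2 \sum_z P x y1 y2 z = 1.

Variable P : X -> Y1 -> Y2 -> Z -> R.

Definition chW (x : X) (y1 : Y1) : R := \sum_y2 \sum_z P x y1 y2 z.
Definition chV (x : X) (y2 : Y2) : R := \sum_y1 \sum_z P x y1 y2 z.
Definition chQ (x : X) (z : Z) : R := \sum_y1 \sum_y2 P x y1 y2 z.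
Definition chY12 (x : X) (y1 : Y1) (y2 : Y2) : R := \sum_z P x y1 y2 z.

(* covert capacity L*(P_{Y,Z|X}) of a point-to-point channel with a warden,
   given by its legitimate channel Wc and warden channel Q; the maximum over
   probability vectors (p_1,...,p_K) is rendered as a supremum. *)
Definition Lstar (T : finType) (Wc : X -> T -> R) (Q : X -> Z -> R) : R :=
  sup [set v | exists p : 'I_K -> R, is_pmf p /\
        v = Num.sqrt (2 * (\sum_(k < K) p k * KL (Wc (lift ord0 k)) (Wc ord0)) ^+ 2
               / chi2 (fun z => \sum_(k < K) p k * Q (lift ord0 k) z) (Q ord0))].

Definition MI (T : finType) (PX : X -> R) (Wc : X -> T -> R) : R :=
  KL (fun xy : X * T => PX xy.1 * Wc xy.1 xy.2)
     (fun xy : X * T => PX xy.1 * \sum_x' PX x' * Wc x' xy.2).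

Record code (n : nat) := Code {
  cM1 : nat; cM2 : nat; cKey : nat;
  cM1_gt0 : (0 < cM1)%N; cM2_gt0 : (0 < cM2)%N; cKey_gt0 : (0 < cKey)%N;
  enc : 'I_cM1 -> 'I_cM2 -> 'I_cKey -> {ffun 'I_n -> X};
  dec1 : {ffun 'I_n -> Y1} -> 'I_cKey -> 'I_cM1;
  dec2 : {ffun 'I_n -> Y2} -> 'I_cKey -> 'I_cM2 }.

Definition err_prob n (c : code n) : R :=
  ((cM1 c * cM2 c * cKey c)%N%:R)^-1 *
  \sum_(w1 : 'I_(cM1 c)) \sum_(w2 : 'I_(cM2 c)) \sum_(s : 'I_(cKey c))
   \sum_(y1n : {ffun 'I_n -> Y1}) \sum_(y2n : {ffun 'I_n -> Y2})
     (\prod_(i < n) chY12 (enc w1 w2 s i) (y1n i) (y2n i)) *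
     ((dec1 y1n s != w1) || (dec2 y2n s != w2))%:R.

Definition warden_out n (c : code n) (zn : {ffun 'I_n -> Z}) : R :=
  ((cM1 c * cM2 c * cKey c)%N%:R)^-1 *
  \sum_(w1 : 'I_(cM1 c)) \sum_(w2 : 'I_(cM2 c)) \sum_(s : 'I_(cKey c))
     \prod_(i < n) chQ (enc w1 w2 s i) (zn i).

Definition Q0n n (zn : {ffun 'I_n -> Z}) : R := \prod_(i < n) chQ ord0 (zn i).

Definition achievable (eps delta : R) (L : R * R) : Prop :=
  0 <= L.1 /\ 0 <= L.2 /\
  exists c : forall n, code n,
    (forall n, KL (@warden_out n (c n)) (@Q0n n) <= delta) /\
    (L.1%:E <= limn_einf (fun n => (ln (cM1 (c n))%:R / Num.sqrt (n%:R * delta))%:E))%E /\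
    (L.2%:E <= limn_einf (fun n => (ln (cM2 (c n))%:R / Num.sqrt (n%:R * delta))%:E))%E /\
    (limn_esup (fun n => (err_prob (c n))%:E) <= eps%:E)%E.

Definition Lregion (eps delta : R) : set (R * R) :=
  closure [set L | achievable eps delta L].

Definition covert_capacity_region (delta : R) : set (R * R) :=
  [set L | forall eps, 0 < eps < 1 -> Lregion eps delta L].

End Defs.

(* Main.v *)
From HB Require Import structures.
From mathcomp Require Import all_boot all_order all_algebra.
From mathcomp Require Import all_classical all_reals all_analysis.
From mathcomp Require Import ring lra.
Require Import Defs.
Import Order.TTheory GRing.Theory Num.Theory.
Import numFieldNormedType.Exports.
Set Implicit Arguments.
Unset Strict Implicit.
Unset Printing Implicit Defensive.
Local Open Scope ring_scope.
Local Open Scope classical_set_scope.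

(* Converse.  Say [L1* >= L2*] and put [c = L1* / L2* >= 1].  The hypothesis
   [I(X;Y1) <= c I(X;Y2)] tensorises, because the defect of the chain-rule
   telescoping is [(c - 1)] times a mutual information.  With Fano's inequality
   [log M1 <= I(W1;Y1^n | W2,S) <= c I(X^n;Y2^n | W2,S)] and
   [log M2 <= I(W2;Y2^n | S)], hence, up to the error terms,
   [log M1 + c log M2 <= c I(X^n;Y2^n | S) <= c n \sum_x P(x) D(V_x || V_0)],
   [P] being the average type of the codewords.  Covertness bounds
   [n D(\sum_x P(x) Q_x || Q_0)] by [delta]; a second-order expansion of
   [x ln x] turns this into a chi-square bound, so the right-hand side is at most
   [c L2* sqrt(n delta)] asymptotically.

   Achievability.  The key is the whole random codebook, so the warden sees an
   exact product law and no resolvability argument is needed.  The users share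
   the block by time division; each one decodes by thresholding the likelihood
   ratio of its codeword against the no-input law, a Chernoff bound controlling
   the missed detections and a second moment the false alarms. *)

(** * Mutual information and its tensorisation *)

(** The scale sqrt(n delta) and the formula for L* come from one balance. Using the nonzero letters
    with total probability [kap / sqrt n] costs about [kap ^+ 2 * chi2 / (2 * n)] of divergence per
    slot at the warden, quadratic in [kap], and gains about [kap * D / sqrt n] of rate, linear in
    [kap], where D is the averaged divergence at the receiver. The budget delta caps [kap] at sqrt(2
    delta / chi2). Time division does not split this budget: every slot spends at most delta / n,
    whichever user owns it, while a user owning a fraction lam of the slots keeps the fraction lam
    of its rate. A weak converse suffices, because the factor 1 - eps left by Fano's inequality
    disappears in the intersection over eps. A code has a deterministic encoder and a uniform key,
    so every random choice has to be uniform on a finite set. The sparse letter laws are therefore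
    pushed forward from the uniform law on ['I_n], which brings rounded probabilities and a limit
    argument. *)

Section Entropy.
Variable R : realType.
Implicit Types (A B X Y T : finType) (c : R).

Definition xlnx (x : R) : R := x * ln x.

Lemma xlnx0 : xlnx 0 = 0.
Proof. by rewrite /xlnx mul0r. Qed.

Lemma xlnx1 : xlnx 1 = 0.
Proof. by rewrite /xlnx ln1 mulr0. Qed.

Lemma xlnxM (x y : R) : 0 <= x -> 0 <= y -> xlnx (x * y) = y * xlnx x + x * xlnx y.
Proof.
rewrite !le0r => /predU1P[->|x0]; first by rewrite !(mul0r, mulr0, xlnx0, addr0).
move=> /predU1P[->|y0]; first by rewrite !(mul0r, mulr0, xlnx0, addr0).
by rewrite /xlnx lnM ?posrE//; ring.
Qed.

Lemma mul_ln_le (x y : R) : 0 <= x -> 0 <= y -> (x != 0 -> y != 0) ->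
  x * ln y <= xlnx x + (y - x).
Proof.
rewrite le0r => /predU1P[->|x0] y0 xy.
  by rewrite xlnx0 mul0r subr0 add0r.
have {}y0 : 0 < y by rewrite lt_neqAle eq_sym xy ?gt_eqF.
have yx0 : 0 < y / x by rewrite divr_gt0.
have : ln (1 + (y / x - 1)) <= y / x - 1 by apply: le_ln1Dx; lra.
have -> : 1 + (y / x - 1) = y / x by ring.
rewrite ln_div ?posrE// -(ler_pM2l x0) !mulrBr mulr1 /xlnx => h.
have e : x * (y / x) = y by rewrite mulrCA divff ?mulr1// gt_eqF.
rewrite e in h; lra.
Qed.

(** The linear terms of [mul_ln_le] sum to the difference of the total masses, so comparing masses
    is enough and unnormalised measures are covered. *)
Lemma gibbs T (p q : T -> R) : (forall t, 0 <= p t) -> (forall t, 0 <= q t) ->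
  (forall t, p t != 0 -> q t != 0) -> \sum_t q t <= \sum_t p t ->
  \sum_t p t * ln (q t) <= \sum_t xlnx (p t).
Proof.
move=> p0 q0 pq le_qp.
apply: le_trans (_ : \sum_t (xlnx (p t) + (q t - p t)) <= _).
  by apply: ler_sum => t _; apply: mul_ln_le => //; exact: pq.
by rewrite big_split/= sumrB gerDl subr_le0.
Qed.

Lemma sum_neq0 T (f : T -> R) t0 : (forall t, 0 <= f t) -> f t0 != 0 ->
  \sum_t f t != 0.
Proof.
move=> f0 ft0; rewrite gt_eqF// (bigD1 t0)//= ltr_pwDl ?sumr_ge0//.
by rewrite lt_neqAle eq_sym ft0 f0.
Qed.

(* Mutual information of the input measure [p] and the channel [U]; [p] need
   not be normalised, which makes [mutinf] additive over conditionings: the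
   value for a disintegration [p = \sum_t p_t] is [\sum_t mutinf U p_t]. *)
Definition mutinf A B (U : A -> B -> R) (p : A -> R) : R :=
  \sum_a p a * (\sum_b xlnx (U a b)) - \sum_b xlnx (\sum_a p a * U a b)
  + xlnx (\sum_a p a).

(** The rows of [U] sum to one, so scaling adds [xlnx c] times the total mass both to the output
    term and to the last term of [mutinf]; the two cancel. *)
Lemma mutinfZ A B (U : A -> B -> R) (p : A -> R) c : 0 <= c ->
  (forall a, 0 <= p a) -> (forall a, is_pmf (U a)) ->
  mutinf U (fun a => c * p a) = c * mutinf U p.
Proof.
move=> c0 p0 pU; rewrite /mutinf.
have -> : \sum_a c * p a * (\sum_b xlnx (U a b)) =
          c * \sum_a p a * (\sum_b xlnx (U a b)).
  by rewrite mulr_sumr; apply: eq_bigr => a _; rewrite mulrA.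
have -> : \sum_b xlnx (\sum_a c * p a * U a b) =
   c * (\sum_b xlnx (\sum_a p a * U a b)) + xlnx c * \sum_a p a.
  transitivity (\sum_b (c * xlnx (\sum_a p a * U a b) +
                        xlnx c * \sum_a p a * U a b)).
    apply: eq_bigr => b _.
    rewrite [RHS]addrC [xlnx c * _]mulrC -xlnxM//; last first.
      by apply: sumr_ge0 => a _; rewrite mulr_ge0// (pU a).1.
    by rewrite mulr_sumr; congr xlnx; apply: eq_bigr => a _; rewrite mulrA.
  rewrite big_split/= -!mulr_sumr exchange_big/=; congr (_ + _ * _).
  by apply: eq_bigr => a _; rewrite -mulr_sumr (pU a).2 mulr1.
rewrite -mulr_sumr xlnxM ?sumr_ge0//; ring.
Qed.

(** Lets a bound on input measures over words be applied to messages, whose channel factors through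
    the encoder. *)
Lemma mutinf_pushforward A B T (U : A -> B -> R) (f : T -> A) (p : T -> R) :
  mutinf (fun t => U (f t)) p = mutinf U (fun a => \sum_(t | f t == a) p t).
Proof.
have E (F : A -> R) : \sum_t p t * F (f t) =
    \sum_a (\sum_(t | f t == a) p t) * F a.
  rewrite (partition_big f predT)//=; apply: eq_bigr => a _.
  by rewrite mulr_suml; apply: eq_bigr => t /eqP ->.
rewrite /mutinf (E (fun a => \sum_b xlnx (U a b))); congr (_ - _ + xlnx _).
  by apply: eq_bigr => b _; rewrite (E (U^~ b)).
by rewrite (partition_big f predT).
Qed.

(** This is [mutinf] of the product channel, curried so that either letter can be marginalised by a
    plain sum. *)
Definition mutinf2 A X B Y (U : A -> B -> R) (W : X -> Y -> R) (p : A -> X -> R) : R :=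
  \sum_a \sum_x p a x * (\sum_b \sum_y xlnx (U a b * W x y))
  - \sum_b \sum_y xlnx (\sum_a \sum_x p a x * (U a b * W x y))
  + xlnx (\sum_a \sum_x p a x).

Lemma mutinf2E A X B Y (U : A -> B -> R) (W : X -> Y -> R) (p : A -> X -> R) :
  (forall a, is_pmf (U a)) -> (forall x, is_pmf (W x)) ->
  mutinf2 U W p =
  \sum_a (\sum_x p a x) * (\sum_b xlnx (U a b))
  + \sum_x (\sum_a p a x) * (\sum_y xlnx (W x y))
  - \sum_b \sum_y xlnx (\sum_a \sum_x p a x * (U a b * W x y))
  + xlnx (\sum_a \sum_x p a x).
Proof.
move=> pU pW; rewrite /mutinf2; congr (_ - _ + _).
have E a x : \sum_b \sum_y xlnx (U a b * W x y) =
    \sum_b xlnx (U a b) + \sum_y xlnx (W x y).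
  transitivity (\sum_b (xlnx (U a b) + U a b * \sum_y xlnx (W x y))).
    apply: eq_bigr => b _.
    transitivity (\sum_y (W x y * xlnx (U a b) + U a b * xlnx (W x y))).
      by apply: eq_bigr => y _; rewrite xlnxM ?(pU a).1 ?(pW x).1.
    by rewrite big_split/= -mulr_suml (pW x).2 mul1r -mulr_sumr.
  by rewrite big_split/= -mulr_suml (pU a).2 mul1r.
transitivity (\sum_a \sum_x (p a x * (\sum_b xlnx (U a b)) +
                             p a x * (\sum_y xlnx (W x y)))).
  by apply: eq_bigr => a _; apply: eq_bigr => x _; rewrite E mulrDr.
under eq_bigr do rewrite big_split/= -mulr_suml.
rewrite big_split/=; congr (_ + _); rewrite exchange_big/=.
by apply: eq_bigr => x _; rewrite mulr_suml.
Qed.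

(** The left side is I(X;Y | B), the weight of [b] staying inside the unnormalised input measure.
    Expressed in the entropy terms of [mutinf2E], the chain rules become linear identities that
    [ring] can close. *)
Lemma mutinf_condl A X B Y (U : A -> B -> R) (W : X -> Y -> R) (p : A -> X -> R) :
  (forall a, is_pmf (U a)) ->
  \sum_b mutinf W (fun x => \sum_a p a x * U a b) =
  \sum_x (\sum_a p a x) * (\sum_y xlnx (W x y))
  - \sum_b \sum_y xlnx (\sum_a \sum_x p a x * (U a b * W x y))
  + \sum_b xlnx (\sum_a (\sum_x p a x) * U a b).
Proof.
move=> pU; rewrite /mutinf big_split/= sumrB; congr (_ - _ + _).
- rewrite exchange_big/=; apply: eq_bigr => x _.
  rewrite -mulr_suml exchange_big/=; congr (_ * _).
  by apply: eq_bigr => a _; rewrite -mulr_sumr (pU a).2 mulr1.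
- apply: eq_bigr => b _; apply: eq_bigr => y _; congr xlnx.
  rewrite exchange_big/=; apply: eq_bigr => x _.
  by rewrite mulr_suml; apply: eq_bigr => a _; rewrite mulrA.
- apply: eq_bigr => b _; congr xlnx; rewrite exchange_big/=.
  by apply: eq_bigr => a _; rewrite mulr_suml.
Qed.

Lemma mutinf_condr A X B Y (U : A -> B -> R) (W : X -> Y -> R) (p : A -> X -> R) :
  (forall x, is_pmf (W x)) ->
  \sum_y mutinf U (fun a => \sum_x p a x * W x y) =
  \sum_a (\sum_x p a x) * (\sum_b xlnx (U a b))
  - \sum_b \sum_y xlnx (\sum_a \sum_x p a x * (U a b * W x y))
  + \sum_y xlnx (\sum_x (\sum_a p a x) * W x y).
Proof.
move=> pW; rewrite (mutinf_condl U (fun x a => p a x) pW).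
congr (_ - _ + _); rewrite exchange_big/=.
apply: eq_bigr => b _; apply: eq_bigr => y _; congr xlnx.
rewrite exchange_big/=; apply: eq_bigr => a _; apply: eq_bigr => x _.
by rewrite [W x y * _]mulrC.
Qed.

(** Gibbs' inequality against the product of the marginals divided by the total mass [s], which has
    mass [s] again: this is I(B;Y) >= 0. The division by [s] is why the zero measure is treated
    apart. *)
Lemma indep_xlnx_le B Y (q : B -> Y -> R) : (forall b y, 0 <= q b y) ->
  \sum_b xlnx (\sum_y q b y) + \sum_y xlnx (\sum_b q b y) <=
  \sum_b \sum_y xlnx (q b y) + xlnx (\sum_b \sum_y q b y).
Proof.
move=> q0; set s := \sum_b \sum_y q b y.
have s0 : 0 <= s by apply: sumr_ge0 => b _; apply: sumr_ge0.
have [s_eq0|s_neq0] := eqVneq s 0.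
  have qe b y : q b y = 0.
    apply/eqP; apply/negPn/negP => qby; move: s_eq0; apply/eqP.
    apply: (@sum_neq0 _ _ b) => [b'|]; first exact: sumr_ge0.
    exact: (@sum_neq0 _ _ y).
  rewrite s_eq0 xlnx0 addr0 !big1// => [b _|y _|b _].
  - by rewrite big1// => y _; rewrite qe xlnx0.
  - by rewrite big1 ?xlnx0// => b _; rewrite qe.
  - by rewrite big1 ?xlnx0// => y _; rewrite qe.
have sp : 0 < s by rewrite lt_neqAle eq_sym s_neq0.
pose qB b := \sum_y q b y; pose qY y := \sum_b q b y.
have qB0 b : 0 <= qB b by apply: sumr_ge0.
have qY0 y : 0 <= qY y by apply: sumr_ge0.
have qBn b y : q b y != 0 -> qB b != 0 by exact: sum_neq0.
have qYn b y : q b y != 0 -> qY y != 0 by move=> h; apply: (@sum_neq0 _ _ b).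
have := @gibbs (B * Y)%type (fun u => q u.1 u.2) (fun u => qB u.1 * qY u.2 / s).
have -> : \sum_u q u.1 u.2 = s :> R by rewrite /s pair_big.
have -> : \sum_(u : B * Y) qB u.1 * qY u.2 / s = s.
  rewrite -(pair_big xpredT xpredT (fun b y => qB b * qY y / s))/=.
  under eq_bigr do rewrite -mulr_suml -mulr_sumr.
  have -> : \sum_y qY y = s by rewrite /s exchange_big.
  by rewrite -!mulr_suml mulfK.
move=> /(_ _ _ _ (lexx _)) h.
have {h} : \sum_b \sum_y q b y * ln (qB b * qY y / s) <= \sum_b \sum_y xlnx (q b y).
  rewrite !pair_big/=; apply: h => //= [[b y]|[b y]]/=.
    by rewrite divr_ge0// mulr_ge0.
  by move=> h; rewrite mulf_neq0 ?invr_eq0// mulf_neq0 ?(qBn b y)// ?(qYn b y).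
rewrite -(lerD2r (xlnx s)); apply: le_trans.
rewrite le_eqVlt; apply/orP; left; apply/eqP.
transitivity (\sum_b \sum_y (q b y * ln (qB b) + q b y * ln (qY y) - q b y * ln s)
   + xlnx s).
  under [in RHS]eq_bigr do rewrite sumrB big_split/= -mulr_suml.
  rewrite sumrB big_split/=; set a := \sum_b _; set d := \sum_y _.
  have -> : \sum_i \sum_i0 q i i0 * ln (qY i0) = d.
    by rewrite exchange_big/=; apply: eq_bigr => y _; rewrite -mulr_suml.
  have -> : \sum_i \sum_i0 q i i0 * ln s = xlnx s.
    by rewrite /xlnx /s mulr_suml; apply: eq_bigr => b _; rewrite mulr_suml.
  ring.
congr (_ + _); apply: eq_bigr => b _; apply: eq_bigr => y _.
have [->|qn] := eqVneq (q b y) 0; first by rewrite !mul0r subr0 addr0.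
have qb : 0 < qB b by rewrite lt_neqAle eq_sym qB0 (qBn b y).
have qy : 0 < qY y by rewrite lt_neqAle eq_sym qY0 (qYn b y).
rewrite ln_div ?posrE ?mulr_gt0// lnM ?posrE//; ring.
Qed.

(* Condition the second letter on the first output of [U1] and the first letter
   on the second output of [W2]; for [c >= 1] the excess
   [(c - 1) * I(B1; Y2)] is nonnegative. *)
Lemma mutinf2_le A X B1 B2 Y1 Y2 (U1 : A -> B1 -> R) (U2 : A -> B2 -> R)
    (W1 : X -> Y1 -> R) (W2 : X -> Y2 -> R) (p : A -> X -> R) c :
  (forall a, is_pmf (U1 a)) -> (forall a, is_pmf (U2 a)) ->
  (forall x, is_pmf (W1 x)) -> (forall x, is_pmf (W2 x)) ->
  1 <= c ->
  (forall r, (forall a, 0 <= r a) -> mutinf U1 r <= c * mutinf U2 r) ->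
  (forall r, (forall x, 0 <= r x) -> mutinf W1 r <= c * mutinf W2 r) ->
  (forall a x, 0 <= p a x) ->
  mutinf2 U1 W1 p <= c * mutinf2 U2 W2 p.
Proof.
move=> pU1 pU2 pW1 pW2 c1 hU hW p0.
have l1 : \sum_b mutinf W1 (fun x => \sum_a p a x * U1 a b) <=
          c * \sum_b mutinf W2 (fun x => \sum_a p a x * U1 a b).
  rewrite mulr_sumr; apply: ler_sum => b _; apply: hW => x.
  by apply: sumr_ge0 => a _; rewrite mulr_ge0// (pU1 a).1.
have l2 : \sum_y mutinf U1 (fun a => \sum_x p a x * W2 x y) <=
          c * \sum_y mutinf U2 (fun a => \sum_x p a x * W2 x y).
  rewrite mulr_sumr; apply: ler_sum => y _; apply: hU => a.
  by apply: sumr_ge0 => x _; rewrite mulr_ge0// (pW2 x).1.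
have := @indep_xlnx_le B1 Y2 (fun b y => \sum_a \sum_x p a x * (U1 a b * W2 x y)).
have -> : \sum_b xlnx (\sum_y \sum_a \sum_x p a x * (U1 a b * W2 x y)) =
          \sum_b xlnx (\sum_a (\sum_x p a x) * U1 a b).
  apply: eq_bigr => b _; congr xlnx; rewrite exchange_big/=.
  apply: eq_bigr => a _; rewrite exchange_big/= mulr_suml.
  by apply: eq_bigr => x _; rewrite -!mulr_sumr (pW2 x).2 mulr1.
have -> : \sum_y xlnx (\sum_b \sum_a \sum_x p a x * (U1 a b * W2 x y)) =
          \sum_y xlnx (\sum_x (\sum_a p a x) * W2 x y).
  apply: eq_bigr => y _; congr xlnx; rewrite exchange_big/=.
  under eq_bigr do rewrite exchange_big/=.
  rewrite exchange_big/=; apply: eq_bigr => x _; rewrite mulr_suml.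
  by apply: eq_bigr => a _; rewrite -mulr_sumr -mulr_suml (pU1 a).2 mul1r.
have -> : \sum_b \sum_y \sum_a \sum_x p a x * (U1 a b * W2 x y) =
          \sum_a \sum_x p a x.
  rewrite (eq_bigr (fun b => \sum_a \sum_x \sum_y p a x * (U1 a b * W2 x y))); last first.
    move=> b _; rewrite exchange_big/=; apply: eq_bigr => a _.
    by rewrite exchange_big.
  rewrite exchange_big/=; apply: eq_bigr => a _; rewrite exchange_big/=.
  apply: eq_bigr => x _; under eq_bigr do rewrite -!mulr_sumr (pW2 x).2 mulr1.
  by rewrite -mulr_sumr (pU1 a).2 mulr1.
move=> /(_ _) l3.
have {l3} : 0 <= (c - 1) * (\sum_b \sum_y xlnx (\sum_a \sum_x p a x * (U1 a b * W2 x y))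
   + xlnx (\sum_a \sum_x p a x) - (\sum_b xlnx (\sum_a (\sum_x p a x) * U1 a b)
   + \sum_y xlnx (\sum_x (\sum_a p a x) * W2 x y))).
  rewrite mulr_ge0 ?subr_ge0//; apply: l3 => b y.
  apply: sumr_ge0 => a _; apply: sumr_ge0 => x _.
  by rewrite !mulr_ge0// ?(pU1 a).1 ?(pW2 x).1.
move: l1 l2; rewrite (mutinf_condl W1 p pU1) (mutinf_condl W2 p pU1).
rewrite (mutinf_condr U1 p pW2) (mutinf_condr U2 p pW2) !mutinf2E//.
rewrite -subr_ge0 => l1; rewrite -subr_ge0 => l2 l3; rewrite -subr_ge0.
apply: le_trans (addr_ge0 (addr_ge0 l1 l2) l3) _.
by rewrite le_eqVlt; apply/orP; left; apply/eqP; ring.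
Qed.

Definition fcons n (T : finType) (t : T) (f : {ffun 'I_n -> T}) : {ffun 'I_n.+1 -> T} :=
  [ffun i => oapp f t (unlift ord0 i)].

Lemma fcons0 n (T : finType) (t : T) (f : {ffun 'I_n -> T}) : fcons t f ord0 = t.
Proof. by rewrite ffunE unlift_none. Qed.

Lemma fconsS n (T : finType) (t : T) (f : {ffun 'I_n -> T}) i :
  fcons t f (lift ord0 i) = f i.
Proof. by rewrite ffunE liftK. Qed.

Lemma sum_fcons n T (F : {ffun 'I_n.+1 -> T} -> R) :
  \sum_g F g = \sum_t \sum_f F (fcons t f).
Proof.
rewrite pair_big/= (reindex (fun u : T * {ffun 'I_n -> T} => fcons u.1 u.2))//=.
apply: onW_bij; exists (fun g : {ffun 'I_n.+1 -> T} => (g ord0, [ffun i : 'I_n => g (lift ord0 i)])).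
  move=> [t f]/=; rewrite fcons0; congr (_, _); apply/ffunP => i.
  by rewrite ffunE fconsS.
move=> g; apply/ffunP => i; have [j ->|->] := unliftP ord0 i.
  by rewrite fconsS ffunE.
by rewrite fcons0.
Qed.

Definition chn X Y (W : X -> Y -> R) n (x : {ffun 'I_n -> X}) (y : {ffun 'I_n -> Y}) : R :=
  \prod_i W (x i) (y i).

Lemma sum_prod_ffun n T (F : 'I_n -> T -> R) :
  \sum_(f : {ffun 'I_n -> T}) \prod_i F i (f i) = \prod_i \sum_t F i t.
Proof. by rewrite bigA_distr_bigA. Qed.

Lemma chn_pmf X Y (W : X -> Y -> R) n (x : {ffun 'I_n -> X}) :
  (forall x, is_pmf (W x)) -> is_pmf (chn W x).
Proof.
move=> pW; split=> [y|]; first by apply: prodr_ge0 => i _; apply: (pW _).1.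
by rewrite (sum_prod_ffun (fun i => W (x i))) big1// => i _; apply: (pW _).2.
Qed.

Lemma chn_cons X Y (W : X -> Y -> R) n x (f : {ffun 'I_n -> X}) y (g : {ffun 'I_n -> Y}) :
  chn W (fcons x f) (fcons y g) = W x y * chn W f g.
Proof.
rewrite /chn big_ord_recl !fcons0; congr (_ * _).
by apply: eq_bigr => i _; rewrite !fconsS.
Qed.

Lemma mutinf_chnS X Y (W : X -> Y -> R) n (p : {ffun 'I_n.+1 -> X} -> R) :
  mutinf (@chn _ _ W n.+1) p =
  mutinf2 W (@chn _ _ W n) (fun x f => p (fcons x f)).
Proof.
rewrite /mutinf /mutinf2 !sum_fcons; congr (_ - _ + _).
  apply: eq_bigr => x _; apply: eq_bigr => f _; congr (_ * _).
  rewrite sum_fcons; apply: eq_bigr => y _; apply: eq_bigr => g _.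
  by rewrite chn_cons.
apply: eq_bigr => y _; apply: eq_bigr => g _; congr xlnx; rewrite sum_fcons.
by apply: eq_bigr => x _; apply: eq_bigr => f _; rewrite chn_cons.
Qed.

(** Induction on the length, one letter being split off by [mutinf_chnS]. At length 0 both sides
    vanish even for an unnormalised measure, since the last two terms of [mutinf] cancel. *)
Lemma mutinf_chn_le X Y1 Y2 (W1 : X -> Y1 -> R) (W2 : X -> Y2 -> R) c n
    (p : {ffun 'I_n -> X} -> R) :
  (forall x, is_pmf (W1 x)) -> (forall x, is_pmf (W2 x)) -> 1 <= c ->
  (forall r, (forall x, 0 <= r x) -> mutinf W1 r <= c * mutinf W2 r) ->
  (forall f, 0 <= p f) ->
  mutinf (@chn _ _ W1 n) p <= c * mutinf (@chn _ _ W2 n) p.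
Proof.
move=> pW1 pW2 c1 hW; elim: n p => [|n IH] p p0; last first.
  rewrite !mutinf_chnS; apply: mutinf2_le => //.
  - by move=> a; apply: chn_pmf.
  - by move=> a; apply: chn_pmf.
have E Y (W : X -> Y -> R) : mutinf (@chn _ _ W 0) p = 0.
  have e0 T (F : {ffun 'I_0 -> T} -> R) : \sum_f F f = F (ffun0 (card_ord 0)).
    rewrite (bigD1 (ffun0 (card_ord 0)))//= big1 ?addr0// => f /eqP[].
    by apply/ffunP => -[].
  by rewrite /mutinf !e0 /chn !big_ord0 /xlnx ln1 mulr1; ring.
by rewrite !E mulr0.
Qed.

End Entropy.

(** * Second-order bounds and Fano's inequality *)

Section XlnxBounds.
Variable R : realType.
Implicit Types (a k y : R).

Lemma ln_ge_subV y : 0 < y -> 1 - y^-1 <= ln y.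
Proof.
move=> y0; have yV0 : 0 < y^-1 by rewrite invr_gt0.
have : ln (1 + (y^-1 - 1)) <= y^-1 - 1 by apply: le_ln1Dx; lra.
have -> : 1 + (y^-1 - 1) = y^-1 by ring.
by rewrite lnV ?posrE//; lra.
Qed.

Lemma ln_le_sub1 y : 0 < y -> ln y <= y - 1.
Proof.
move=> y0; have : ln (1 + (y - 1)) <= y - 1 by apply: le_ln1Dx; lra.
by have -> : 1 + (y - 1) = y by ring.
Qed.

Lemma xlnx_sub_quad_is_derive k y : 0 < y ->
  is_derive y 1 (fun z => xlnx z - z - k / 2 * (z - 1) ^+ 2) (ln y - k * (y - 1)).
Proof.
move=> y0; have dln := is_derive1_ln y0.
rewrite /xlnx; apply: is_derive_eq; rewrite /GRing.scale/= divff ?gt_eqF//; lra.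
Qed.

(** Mean value theorem between 1 and [y]. The curvature [k] is left free: with [k = (1 + a)^-1] the
    factor [ln c - k * (c - 1)] has the sign of [y - 1] as long as [y <= 1 + a], and with
    [k = (1 - a)^-1] the opposite sign as long as [1 - a <= y]. This gives the two quadratic bounds
    below. *)
Lemma xlnx_taylor k y : 0 < y -> exists2 c,
  (1 <= c <= y) || (y <= c <= 1) &
  xlnx y - (y - 1) - k / 2 * (y - 1) ^+ 2 = (ln c - k * (c - 1)) * (y - 1).
Proof.
move=> y0; pose f z : R := xlnx z - z - k / 2 * (z - 1) ^+ 2.
have f1 : f 1 = - 1 by rewrite /f /xlnx ln1; ring.
have mvt (u v : R) : 0 < u -> u <= v ->
    exists2 c, c \in `[u, v]%R & f v - f u = (ln c - k * (c - 1)) * (v - u).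
  move=> u0 uv; have := @MVT_segment _ f (fun z => ln z - k * (z - 1)) u v uv.
  apply.
    move=> z; rewrite in_itv/= => /andP[uz _].
    by apply: xlnx_sub_quad_is_derive; apply: lt_trans uz.
  apply: derivable_within_continuous => z; rewrite in_itv/= => /andP[uz _].
  by apply: ex_derive; apply: xlnx_sub_quad_is_derive; apply: lt_le_trans uz.
have [y1|y1] := leP 1 y.
  have [c] := mvt 1 y ltr01 y1; rewrite in_itv/= => cI e.
  by exists c; [rewrite cI|rewrite -e f1 /f; ring].
have [c] := mvt y 1 y0 (ltW y1); rewrite in_itv/= => cI e.
exists c; first by rewrite cI orbT.
by transitivity (- (f 1 - f y)); [rewrite f1 /f|rewrite e]; ring.
Qed.

Lemma xlnx_quad_ge a y : 0 <= a -> 0 <= y <= 1 + a ->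
  (y - 1) ^+ 2 / (2 * (1 + a)) <= xlnx y - (y - 1).
Proof.
move=> a0 /andP[]; rewrite le0r => /predU1P[-> _|y0 ya].
  rewrite xlnx0 ler_pdivrMr; last lra.
  by nra.
have [c cI] := xlnx_taylor (1 + a)^-1 y0.
have a1 : 0 < 1 + a by lra.
have k0 : 0 < (1 + a)^-1 by rewrite invr_gt0.
suff h : 0 <= (ln c - (1 + a)^-1 * (c - 1)) * (y - 1).
  move=> e; rewrite -e in h.
  have -> : (y - 1) ^+ 2 / (2 * (1 + a)) = (1 + a)^-1 / 2 * (y - 1) ^+ 2.
    by field; rewrite gt_eqF.
  by lra.
case/orP: cI => /andP[c1 c2].
  apply: mulr_ge0; last lra.
  have c0 : 0 < c by lra.
  rewrite subr_ge0; apply: le_trans (ln_ge_subV c0).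
  have -> : 1 - c^-1 = c^-1 * (c - 1) by field; rewrite gt_eqF.
  rewrite ler_wpM2r//; [lra|]; rewrite lef_pV2 ?posrE//; lra.
rewrite -mulrNN; apply: mulr_ge0; last lra.
have c0 : 0 < c by lra.
rewrite oppr_ge0 subr_le0; apply: le_trans (ln_le_sub1 c0) _.
have : (1 + a)^-1 <= 1 by rewrite invf_le1//; lra.
by nra.
Qed.

Lemma xlnx_quad_le a y : 0 <= a < 1 -> 1 - a <= y ->
  xlnx y - (y - 1) <= (y - 1) ^+ 2 / (2 * (1 - a)).
Proof.
move=> /andP[a0 a1] ya; have y0 : 0 < y by lra.
have [c cI] := xlnx_taylor (1 - a)^-1 y0.
have ap : 0 < 1 - a by lra.
have k0 : 0 < (1 - a)^-1 by rewrite invr_gt0.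
suff h : (ln c - (1 - a)^-1 * (c - 1)) * (y - 1) <= 0.
  move=> e; rewrite -e in h.
  have -> : (y - 1) ^+ 2 / (2 * (1 - a)) = (1 - a)^-1 / 2 * (y - 1) ^+ 2.
    by field; rewrite gt_eqF.
  by lra.
case/orP: cI => /andP[c1 c2].
  apply: mulr_le0_ge0; last lra.
  have c0 : 0 < c by lra.
  rewrite subr_le0; apply: le_trans (ln_le_sub1 c0) _.
  have : 1 <= (1 - a)^-1 by rewrite invf_ge1//; lra.
  by nra.
apply: mulr_ge0_le0; last lra.
have c0 : 0 < c by lra.
rewrite subr_ge0; apply: le_trans (ln_ge_subV c0).
have -> : 1 - c^-1 = c^-1 * (c - 1) by field; rewrite gt_eqF.
rewrite ler_wnM2r//; [lra|]; rewrite lef_pV2 ?posrE//; lra.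
Qed.

(** From [(1 - y) * expR y <= 1], because (1 - y)(1 + y + 2 y^2) = 1 + y^2 (1 - 2 y) is at least 1
    when y <= 1/2. *)
Lemma expR_le_quad y : y <= 2^-1 -> expR y <= 1 + y + 2 * y ^+ 2.
Proof.
move=> y2; have : 1 + - y <= expR (- y) by exact: expR_ge1Dx.
rewrite expRN => h; have e0 := expR_gt0 y.
have h1 : (1 - y) * expR y <= 1 by rewrite -ler_pdivlMr// div1r.
have y0 : 0 < 1 - y by lra.
rewrite -(ler_pM2l y0); apply: le_trans h1 _.
by have := sqr_ge0 y; nra.
Qed.

End XlnxBounds.

Section Converse.
Variable R : realType.
Implicit Types (A B X Y Z T : finType) (c : R).

Lemma KLE T (p q : T -> R) : KL p q = \sum_t p t * ln (p t / q t).
Proof.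
rewrite /KL big_mkcond; apply: eq_bigr => t _.
by case: eqP => //= ->; rewrite mul0r.
Qed.

Lemma mul_ln_div (u v : R) : 0 <= u -> 0 <= v -> (u != 0 -> v != 0) ->
  u * ln (u / v) = xlnx u - u * ln v.
Proof.
rewrite le0r => /predU1P[->|u0] v0 uv; first by rewrite xlnx0 !mul0r subrr.
have {}v0 : 0 < v by rewrite lt_neqAle eq_sym uv ?gt_eqF.
by rewrite ln_div ?posrE// mulrBr.
Qed.

Lemma sum_prod_letter n T (p : 'I_n -> T -> R) (i : 'I_n) (g : T -> R) :
  (forall j, \sum_t p j t = 1) ->
  \sum_(f : {ffun 'I_n -> T}) (\prod_j p j (f j)) * g (f i) = \sum_t p i t * g t.
Proof.
move=> p1; pose F j t := p j t * (if j == i then g t else 1).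
transitivity (\sum_(f : {ffun 'I_n -> T}) \prod_j F j (f j)).
  apply: eq_bigr => f _; rewrite /F big_split/=; congr (_ * _).
  by rewrite -big_mkcond/= big_pred1_eq.
rewrite (sum_prod_ffun F) (bigD1 i)//= [X in _ * X]big1 ?mulr1.
  by rewrite /F eqxx.
move=> j /negPf ji; rewrite -(p1 j).
by apply: eq_bigr => t _; rewrite /F ji mulr1.
Qed.

Lemma ln_prod I (r : seq I) (F : I -> R) : (forall i, 0 < F i) ->
  ln (\prod_(i <- r) F i) = \sum_(i <- r) ln (F i).
Proof.
move=> F0; elim: r => [|i r IH]; first by rewrite !big_nil ln1.
by rewrite !big_cons lnM ?posrE ?prodr_gt0// IH.
Qed.

Lemma chn_neq0 X Y (W : X -> Y -> R) n (x : {ffun 'I_n -> X})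
    (y : {ffun 'I_n -> Y}) i :
  chn W x y != 0 -> W (x i) (y i) != 0.
Proof. by move=> h; apply: contraNneq h => e; rewrite /chn (bigD1 i)//= e mul0r. Qed.

Lemma chn_neq0P X Y (W : X -> Y -> R) n (x : {ffun 'I_n -> X}) (y : {ffun 'I_n -> Y}) :
  (forall i, W (x i) (y i) != 0) -> chn W x y != 0.
Proof. by move=> h; apply/prodf_neq0 => i _. Qed.

(** Gibbs' inequality against the law [q b * k w b], where [k] guesses [w] from [b] by an even
    mixture of the point mass at [dec b] and the uniform law. The point mass gives [ln k >= - ln 2]
    when decoding succeeds, the uniform part [ln k >= - ln 2 - ln M] when it fails; [ln 2] thus
    stands where the binary entropy usually does. *)
Lemma fano M B (U : 'I_M -> B -> R) (dec : B -> 'I_M) : (0 < M)%N ->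
  (forall w, is_pmf (U w)) ->
  (1 - M%:R^-1 * \sum_w \sum_b U w b * (dec b != w)%:R) * ln M%:R - ln 2 <=
  mutinf U (fun=> M%:R^-1).
Proof.
move=> M0 pU; set u : R := M%:R^-1; set e := u * _.
have Mp : 0 < M%:R :> R by rewrite ltr0n.
have u0 : 0 < u by rewrite invr_gt0.
have uM : \sum_(w < M) u = 1.
  by rewrite sumr_const card_ord -mulr_natl mulfV ?gt_eqF.
pose q b := \sum_w u * U w b.
have U0 w b : 0 <= U w b by apply: (pU w).1.
have q0 b : 0 <= q b by apply: sumr_ge0 => w _; rewrite mulr_ge0 ?U0// ltW.
pose k w b : R := (dec b == w)%:R / 2 + u / 2.
have k0 w b : 0 < k w b.
  by rewrite /k ltr_wpDl ?divr_ge0 ?ler0n ?divr_gt0.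
have k1 b : \sum_w k w b = 1.
  rewrite /k big_split/= -!mulr_suml uM (bigD1 (dec b))//= eqxx/= big1; last first.
    by move=> w; rewrite eq_sym => /negPf ->.
  by lra.
have qE : \sum_b q b = 1.
  rewrite /q exchange_big/= -[RHS]uM; apply: eq_bigr => w _.
  by rewrite -mulr_sumr (pU w).2 mulr1.
have lnk w b : - ln 2 - (dec b != w)%:R * ln M%:R <= ln (k w b).
  rewrite /k; case: eqP => _ /=.
    rewrite mul0r subr0 -lnV ?posrE// ler_ln ?posrE ?invr_gt0//; last first.
      by rewrite addr_gt0 ?divr_gt0.
    by rewrite div1r lerDl divr_ge0// ltW.
  by rewrite mul0r add0r mul1r ln_div ?posrE// lnV ?posrE//; lra.
have qn w b : u * U w b != 0 -> q b != 0.
  by apply: sum_neq0 => t; rewrite mulr_ge0 ?U0// ltW.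
have := @gibbs R ('I_M * B)%type (fun t => u * U t.1 t.2) (fun t => q t.2 * k t.1 t.2).
rewrite -(pair_big xpredT xpredT (fun w b => q b * k w b))/=.
rewrite -(pair_big xpredT xpredT (fun w b => u * U w b))/=.
rewrite -(pair_big xpredT xpredT (fun w b => u * U w b * ln (q b * k w b)))/=.
rewrite -(pair_big xpredT xpredT (fun w b => xlnx (u * U w b)))/=.
have -> : \sum_w \sum_b q b * k w b = 1.
  rewrite exchange_big/= -[RHS]qE; apply: eq_bigr => b _.
  by rewrite -mulr_sumr k1 mulr1.
have -> : \sum_w \sum_b u * U w b = 1 by rewrite exchange_big.
move=> /(_ _ _ _ (lexx _)) h.
have {}h := h (fun t => mulr_ge0 (ltW u0) (U0 _ _))
  (fun t => mulr_ge0 (q0 _) (ltW (k0 _ _)))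
  (fun t ht => mulf_neq0 (qn _ _ ht) (lt0r_neq0 (k0 _ _))).
have E1 : \sum_w \sum_b xlnx (u * U w b) = - ln M%:R + \sum_w u * \sum_b xlnx (U w b).
  transitivity (\sum_w (xlnx u + u * \sum_b xlnx (U w b))).
    apply: eq_bigr => w _.
    transitivity (\sum_b (U w b * xlnx u + u * xlnx (U w b))).
      by apply: eq_bigr => b _; rewrite xlnxM// ltW.
    by rewrite big_split/= -mulr_suml (pU w).2 mul1r mulr_sumr.
  rewrite big_split/=; congr (_ + _).
  by rewrite /xlnx -mulr_suml uM mul1r /u lnV ?posrE.
have E2 : \sum_b xlnx (q b) - ln 2 - e * ln M%:R <=
    \sum_w \sum_b u * U w b * ln (q b * k w b).
  apply: le_trans (_ : \sum_w \sum_b (u * U w b * ln (q b) +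
      u * U w b * (- ln 2 - (dec b != w)%:R * ln M%:R)) <= _); last first.
    apply: ler_sum => w _; apply: ler_sum => b _.
    have [->|n0] := eqVneq (u * U w b) 0; first by rewrite !mul0r addr0.
    rewrite lnM ?posrE//; last by rewrite lt_neqAle eq_sym q0 (qn w b).
    by rewrite [leRHS]mulrDr lerD2l ler_wpM2l// mulr_ge0 ?U0// ltW.
  under [leRHS]eq_bigr do rewrite big_split/=.
  rewrite [leRHS]big_split/=.
  have -> : \sum_w \sum_b u * U w b * ln (q b) = \sum_b xlnx (q b).
    by rewrite exchange_big/=; apply: eq_bigr => b _; rewrite -mulr_suml.
  rewrite -!addrA lerD2l.
  have -> : \sum_i \sum_i0 u * U i i0 * (- ln 2 - (dec i0 != i)%:R * ln M%:R) =
     - ln 2 * (\sum_b q b) - e * ln M%:R.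
    have -> : e * ln M%:R = \sum_w \sum_b u * U w b * ((dec b != w)%:R * ln M%:R).
      rewrite /e mulr_sumr mulr_suml; apply: eq_bigr => w _.
      by rewrite mulr_sumr mulr_suml; apply: eq_bigr => b _; ring.
    have -> : - ln 2 * \sum_b q b = \sum_w \sum_b u * U w b * - ln 2.
      rewrite /q exchange_big/= mulr_sumr; apply: eq_bigr => w _.
      by rewrite mulr_sumr; apply: eq_bigr => b _; ring.
    rewrite -sumrB; apply: eq_bigr => w _; rewrite -sumrB.
    by apply: eq_bigr => b _; ring.
  by rewrite qE mulr1.
rewrite /mutinf uM xlnx1 addr0.
rewrite mulrBl mul1r; move: h E1 E2; rewrite /q; lra.
Qed.

End Converse.

(** * The converse at finite blocklength *)

Section BroadcastConverse.
Variable R : realType.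
Implicit Types (A B X Y Z T : finType) (c : R).

Lemma sum_xlnx_chn X Y (V : X -> Y -> R) n (x x0 : {ffun 'I_n -> X}) :
  (forall a, is_pmf (V a)) ->
  (forall i y, V (x0 i) y = 0 -> V (x i) y = 0) ->
  \sum_y (xlnx (chn V x y) - chn V x y * ln (chn V x0 y)) =
  \sum_i KL (V (x i)) (V (x0 i)).
Proof.
move=> pV ac; have V0 a y : 0 <= V a y by apply: (pV a).1.
transitivity (\sum_y \sum_i chn V x y * ln (V (x i) (y i) / V (x0 i) (y i))).
  apply: eq_bigr => y _.
  have [->|n0] := eqVneq (chn V x y) 0.
    by rewrite xlnx0 mul0r subrr big1// => i _; rewrite mul0r.
  have p i : 0 < V (x i) (y i) by rewrite lt_neqAle eq_sym (chn_neq0 i n0) V0.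
  have p0 i : 0 < V (x0 i) (y i).
    rewrite lt_neqAle eq_sym V0 andbT; apply: contraTneq (p i) => /ac ->.
    by rewrite ltxx.
  rewrite /xlnx -mulrBr {2 4}/chn !ln_prod// -sumrB mulr_sumr.
  by apply: eq_bigr => i _; rewrite ln_div ?posrE.
rewrite exchange_big/=; apply: eq_bigr => i _; rewrite KLE.
apply: (@sum_prod_letter R n Y (fun j => V (x j)) i
  (fun t => ln (V (x i) t / V (x0 i) t))) => j.
exact: (pV _).2.
Qed.

Lemma avg_affine n (a b : R) (F : 'I_n -> R) : (0 < n)%N ->
  n%:R^-1 * \sum_i ((1 - F i) * a - b) = (1 - n%:R^-1 * \sum_i F i) * a - b.
Proof.
move=> n0; have n1 : n%:R != 0 :> R by rewrite pnatr_eq0 -lt0n.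
rewrite sumrB -mulr_suml sumrB !sumr_const card_ord -[b *+ n]mulr_natl.
by field.
Qed.

(** The chain rule I(W1;Y2^n | W2) + I(W2;Y2^n) = I(W1,W2;Y2^n) is a cancellation: [F1], averaged
    over [w2], and [c] times [F2] contain the entropies of [U w2] with opposite signs, and [F3]
    bounds what is left. *)
Lemma broadcast_converse_nokey X Y1 Y2 (W : X -> Y1 -> R) (V : X -> Y2 -> R) o c
    n M1 M2 (f : 'I_M1 -> 'I_M2 -> {ffun 'I_n -> X})
    (d1 : {ffun 'I_n -> Y1} -> 'I_M1) (d2 : {ffun 'I_n -> Y2} -> 'I_M2) :
  (forall x, is_pmf (W x)) -> (forall x, is_pmf (V x)) ->
  (forall x y, V o y = 0 -> V x y = 0) -> 1 <= c ->
  (forall r, (forall x, 0 <= r x) -> mutinf W r <= c * mutinf V r) ->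
  (0 < M1)%N -> (0 < M2)%N ->
  (1 - M2%:R^-1 * \sum_w2 M1%:R^-1 * \sum_w1
     \sum_y chn W (f w1 w2) y * (d1 y != w1)%:R) * ln M1%:R - ln 2 +
  c * ((1 - M2%:R^-1 * \sum_w2 M1%:R^-1 * \sum_w1
     \sum_y chn V (f w1 w2) y * (d2 y != w2)%:R) * ln M2%:R - ln 2) <=
  c * (M2%:R^-1 * \sum_w2 M1%:R^-1 * \sum_w1 \sum_i KL (V (f w1 w2 i)) (V o)).
Proof.
move=> pW pV ac c1 hc M10 M20.
set u1 : R := M1%:R^-1; set u2 : R := M2%:R^-1.
have u1p : 0 < u1 by rewrite invr_gt0 ltr0n.
have u2p : 0 < u2 by rewrite invr_gt0 ltr0n.
have u1M : \sum_(w < M1) u1 = 1.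
  by rewrite sumr_const card_ord -mulr_natl mulfV// pnatr_eq0 -lt0n.
have u2M : \sum_(w < M2) u2 = 1.
  by rewrite sumr_const card_ord -mulr_natl mulfV// pnatr_eq0 -lt0n.
have cV0 x (y : {ffun 'I_n -> Y2}) : 0 <= chn V x y by apply: (chn_pmf x pV).1.
pose U w2 y := \sum_w1 u1 * chn V (f w1 w2) y.
have pU w2 : is_pmf (U w2).
  split=> [y|]; first by apply: sumr_ge0 => w1 _; rewrite mulr_ge0// ltW.
  rewrite /U exchange_big/= -[RHS]u1M; apply: eq_bigr => w1 _.
  by rewrite -mulr_sumr (chn_pmf _ pV).2 mulr1.
pose q y := \sum_w2 u2 * U w2 y.
pose S w2 : R := \sum_w1 u1 * \sum_y xlnx (chn V (f w1 w2) y).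
have F1 w2 : (1 - u1 * \sum_w1 \sum_y chn W (f w1 w2) y * (d1 y != w1)%:R)
     * ln M1%:R - ln 2 <= c * (S w2 - \sum_y xlnx (U w2 y)).
  have pC w1 : is_pmf (chn W (f w1 w2)) by exact: chn_pmf.
  apply: le_trans (fano d1 M10 pC) _.
  (* The tensorised inequality concerns measures on words: push the message law forward to the
     codewords, exchange the channels there, and pull back. *)
  rewrite (@mutinf_pushforward _ _ _ _ (@chn R X Y1 W n) (f^~ w2)).
  apply: le_trans (mutinf_chn_le _ _ c1 hc _) _ => // [x|].
    by apply: sumr_ge0 => w _; apply: ltW.
  rewrite ler_wpM2l//; first lra.
  rewrite -(@mutinf_pushforward _ _ _ _ (@chn R X Y2 V n) (f^~ w2)).
  by rewrite /mutinf u1M xlnx1 addr0.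
have F2 : (1 - u2 * \sum_w2 u1 * \sum_w1 \sum_y chn V (f w1 w2) y * (d2 y != w2)%:R)
     * ln M2%:R - ln 2 <= \sum_w2 u2 * (\sum_y xlnx (U w2 y)) - \sum_y xlnx (q y).
  have := fano d2 M20 pU; rewrite /mutinf u2M xlnx1 addr0.
  set a := (X in (1 - u2 * X) * _ - _ <= _ -> _).
  set b := (X in _ -> (1 - u2 * X) * _ - _ <= _).
  suff -> : b = a by [].
  apply: eq_bigr => w2 _; rewrite mulr_sumr.
  under eq_bigr do rewrite mulr_sumr.
  rewrite exchange_big/=; apply: eq_bigr => y _; rewrite /U mulr_suml.
  by apply: eq_bigr => w1 _; rewrite mulrA.
(* By Gibbs' inequality, replacing the true output law [q] inside the logarithm by the no-input
   product law only increases the difference; the result is a divergence, additive over the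
   letters. *)
have F3 : \sum_w2 u2 * S w2 - \sum_y xlnx (q y) <=
    u2 * \sum_w2 u1 * \sum_w1 \sum_i KL (V (f w1 w2 i)) (V o).
  pose x0 : {ffun 'I_n -> X} := [ffun=> o].
  have g : \sum_y q y * ln (chn V x0 y) <= \sum_y xlnx (q y).
    apply: gibbs => [y|y|y|].
    - by apply: sumr_ge0 => w2 _; rewrite mulr_ge0 ?(pU w2).1// ltW.
    - exact: cV0.
    - apply: contraNneq => x0y; apply/eqP/big1 => w2 _; rewrite /U.
      rewrite big1 ?mulr0// => w1 _.
      suff -> : chn V (f w1 w2) y = 0 by rewrite mulr0.
      apply/eqP/negPn/negP => h; move/eqP: x0y; apply/negP.
      apply: chn_neq0P => i; rewrite ffunE.
      by apply: contraNneq (chn_neq0 i h) => /ac ->.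
    - rewrite (chn_pmf _ pV).2 /q exchange_big/= -u2M.
      by apply: ler_sum => w2 _; rewrite -mulr_sumr (pU w2).2 mulr1.
  apply: le_trans (_ : \sum_w2 u2 * S w2 - \sum_y q y * ln (chn V x0 y) <= _).
    by rewrite lerD2l lerN2.
  rewrite le_eqVlt; apply/orP; left; apply/eqP.
  have -> : \sum_y q y * ln (chn V x0 y) = \sum_w2 u2 * \sum_w1 u1 *
      \sum_y chn V (f w1 w2) y * ln (chn V x0 y).
    under eq_bigr do rewrite /q mulr_suml.
    rewrite exchange_big/=; apply: eq_bigr => w2 _.
    rewrite /U mulr_sumr.
    under eq_bigr do rewrite mulr_sumr mulr_suml.
    rewrite exchange_big/=; apply: eq_bigr => w1 _.
    by rewrite !mulr_sumr; apply: eq_bigr => y _; ring.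
  rewrite mulr_sumr -sumrB; apply: eq_bigr => w2 _; rewrite -mulrBr.
  congr (_ * _); rewrite /S -sumrB mulr_sumr; apply: eq_bigr => w1 _.
  rewrite -mulrBr; congr (_ * _); rewrite -sumrB sum_xlnx_chn//.
    by apply: eq_bigr => i _; rewrite ffunE.
  by move=> i y; rewrite ffunE; apply: ac.
have F1' : (1 - u2 * \sum_w2 u1 * \sum_w1 \sum_y chn W (f w1 w2) y * (d1 y != w1)%:R)
     * ln M1%:R - ln 2 <= c * (\sum_w2 u2 * S w2 - \sum_w2 u2 * \sum_y xlnx (U w2 y)).
  rewrite -avg_affine//.
  apply: le_trans (_ : u2 * \sum_w2 c * (S w2 - \sum_y xlnx (U w2 y)) <= _).
    by rewrite ler_wpM2l ?ler_sum// ltW.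
  rewrite -mulr_sumr mulrCA -sumrB mulr_sumr.
  rewrite le_eqVlt; apply/orP; left; apply/eqP; congr (_ * _).
  by apply: eq_bigr => w2 _; rewrite mulrBr.
have c0 : 0 <= c by lra.
have := ler_wpM2l c0 F2; have := ler_wpM2l c0 F3; move: F1'; lra.
Qed.

Definition avg3 (M1 M2 Ks : nat) (F : 'I_M1 -> 'I_M2 -> 'I_Ks -> R) : R :=
  ((M1 * M2 * Ks)%N%:R)^-1 * \sum_w1 \sum_w2 \sum_s F w1 w2 s.

(** The key comes outermost and [w1] innermost, which is the order of conditioning in
    [broadcast_converse_nokey]. *)
Lemma avg3E M1 M2 Ks (F : 'I_M1 -> 'I_M2 -> 'I_Ks -> R) :
  avg3 F = Ks%:R^-1 * \sum_s M2%:R^-1 * \sum_w2 M1%:R^-1 * \sum_w1 F w1 w2 s.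
Proof.
rewrite /avg3 !natrM !invfM.
have -> : \sum_w1 \sum_w2 \sum_s F w1 w2 s = \sum_s \sum_w2 \sum_w1 F w1 w2 s.
  under eq_bigr do rewrite exchange_big/=.
  rewrite exchange_big/=; apply: eq_bigr => s _; exact: exchange_big.
by under [in RHS]eq_bigr do rewrite -mulr_sumr mulrA; rewrite -mulr_sumr; ring.
Qed.

Lemma avg3_swap M1 M2 Ks (F : 'I_M1 -> 'I_M2 -> 'I_Ks -> R) :
  avg3 (fun w2 w1 s => F w1 w2 s) = avg3 F.
Proof. by rewrite /avg3 exchange_big/= (mulnC M1). Qed.

Lemma avg3_le M1 M2 Ks (F G : 'I_M1 -> 'I_M2 -> 'I_Ks -> R) :
  (forall w1 w2 s, F w1 w2 s <= G w1 w2 s) -> avg3 F <= avg3 G.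
Proof.
move=> FG; rewrite ler_wpM2l ?invr_ge0 ?ler0n//.
by apply: ler_sum => w1 _; apply: ler_sum => w2 _; apply: ler_sum.
Qed.

(** The bound for each fixed key is affine in the error probabilities ([avg_affine]), so averaging
    over the key takes no concavity argument. *)
Lemma broadcast_converse X Y1 Y2 (W : X -> Y1 -> R) (V : X -> Y2 -> R) o c
    n M1 M2 Ks (f : 'I_M1 -> 'I_M2 -> 'I_Ks -> {ffun 'I_n -> X})
    (d1 : {ffun 'I_n -> Y1} -> 'I_Ks -> 'I_M1)
    (d2 : {ffun 'I_n -> Y2} -> 'I_Ks -> 'I_M2) :
  (forall x, is_pmf (W x)) -> (forall x, is_pmf (V x)) ->
  (forall x y, V o y = 0 -> V x y = 0) -> 1 <= c ->
  (forall r, (forall x, 0 <= r x) -> mutinf W r <= c * mutinf V r) ->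
  (0 < M1)%N -> (0 < M2)%N -> (0 < Ks)%N ->
  (1 - avg3 (fun w1 w2 s => \sum_y chn W (f w1 w2 s) y * (d1 y s != w1)%:R))
    * ln M1%:R - ln 2 +
  c * ((1 - avg3 (fun w1 w2 s => \sum_y chn V (f w1 w2 s) y * (d2 y s != w2)%:R))
    * ln M2%:R - ln 2) <=
  c * avg3 (fun w1 w2 s => \sum_i KL (V (f w1 w2 s i)) (V o)).
Proof.
move=> pW pV ac c1 hc M10 M20 K0; rewrite !avg3E -!avg_affine//.
rewrite [c * (_ * _)]mulrCA -mulrDr [leRHS]mulrCA ler_wpM2l ?invr_ge0 ?ler0n//.
rewrite !mulr_sumr -big_split/=; apply: ler_sum => s _.
exact: (@broadcast_converse_nokey _ _ _ W V o c n M1 M2 (fun w1 w2 => f w1 w2 s)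
  (d1^~ s) (d2^~ s)).
Qed.

(* The product of the letter-averaged output law is the best product
   approximation of the warden's observation. *)
Lemma covert_converse X Z (Q : X -> Z -> R) o n (I : finType) (u : I -> R)
    (x : I -> {ffun 'I_n -> X}) (Qb : Z -> R) :
  (forall a, is_pmf (Q a)) -> (forall z, 0 < Q o z) ->
  (forall i, 0 < u i) -> \sum_i u i = 1 ->
  (forall z, n%:R * Qb z = \sum_i u i * \sum_j Q (x i j) z) ->
  n%:R * (\sum_z Qb z * ln (Qb z / Q o z)) <=
  KL (fun z => \sum_i u i * chn Q (x i) z) (chn Q [ffun=> o]).
Proof.
case: n x => [|n] x pQ Qo u0 u1 Qbe.
  rewrite mul0r /KL; rewrite big1// => z _.
  rewrite /chn; under [X in X * ln (X / _)]eq_bigr do rewrite big_ord0 mulr1.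
  by rewrite u1 big_ord0 divr1 ln1 mulr0.
have n0 : n.+1%:R != 0 :> R by rewrite pnatr_eq0.
have np : 0 < n.+1%:R :> R by rewrite ltr0n.
have Q0 a z : 0 <= Q a z by apply: (pQ a).1.
have Qb0 z : 0 <= Qb z.
  rewrite -(pmulr_rge0 _ np) Qbe; apply: sumr_ge0 => i _.
  by rewrite mulr_ge0 ?sumr_ge0// ltW.
have Qb1 : \sum_z Qb z = 1.
  apply: (mulfI n0); rewrite mulr1 mulr_sumr; under eq_bigr do rewrite Qbe.
  rewrite exchange_big/=; transitivity (\sum_i u i * n.+1%:R); last first.
    by rewrite -mulr_suml u1 mul1r.
  apply: eq_bigr => i _.
  rewrite -mulr_sumr exchange_big/=; congr (_ * _).
  rewrite (eq_bigr (fun=> 1)) ?sumr_const ?card_ord// => j _.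
  exact: (pQ _).2.
have Qbn i j z : Q (x i j) z != 0 -> Qb z != 0.
  move=> h; suff : n.+1%:R * Qb z != 0 by rewrite mulf_eq0 negb_or => /andP[].
  rewrite Qbe; apply: (@sum_neq0 _ _ _ i) => [i'|].
    by rewrite mulr_ge0 ?sumr_ge0// ltW.
  apply: mulf_neq0; first by rewrite gt_eqF.
  exact: (@sum_neq0 _ _ _ j).
pose q (z : {ffun 'I_n.+1 -> Z}) := \sum_i u i * chn Q (x i) z.
have c0 a (z : {ffun 'I_n.+1 -> Z}) : 0 <= chn Q a z by apply: (chn_pmf a pQ).1.
have q0 z : 0 <= q z by apply: sumr_ge0 => i _; rewrite mulr_ge0// ltW.
have qn z : q z != 0 -> forall j, 0 < Qb (z j).
  move=> qz j; rewrite lt_neqAle eq_sym Qb0 andbT; apply: contraNneq qz => Qbz.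
  apply/eqP/big1 => i _; suff -> : chn Q (x i) z = 0 by rewrite mulr0.
  apply/eqP/negPn/negP => h; move/eqP: Qbz; apply/negP.
  exact: Qbn (chn_neq0 j h).
have g : \sum_z q z * ln (\prod_j Qb (z j)) <= \sum_z xlnx (q z).
  apply: gibbs => // [z|z qz|].
  - exact: prodr_ge0.
  - by apply/prodf_neq0 => j _; rewrite gt_eqF// qn.
  - rewrite (sum_prod_ffun (fun=> Qb)) big1// => //.
    rewrite /q exchange_big/= -u1; apply: ler_sum => i _.
    by rewrite -mulr_sumr (chn_pmf _ pQ).2 mulr1.
have op (z : {ffun 'I_n.+1 -> Z}) : 0 < chn Q [ffun=> o] z.
  by apply: prodr_gt0 => j _; rewrite ffunE.
rewrite -/q KLE.
have -> : \sum_z q z * ln (q z / chn Q [ffun=> o] z) =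
    \sum_z xlnx (q z) - \sum_z q z * ln (chn Q [ffun=> o] z).
  rewrite -sumrB; apply: eq_bigr => z _.
  by apply: mul_ln_div => [||_]; [exact: q0|exact: ltW|rewrite gt_eqF].
apply: le_trans (lerB g (lexx _)).
rewrite -sumrB le_eqVlt; apply/orP; left; apply/eqP.
transitivity (\sum_z \sum_j q z * ln (Qb (z j) / Q o (z j))); last first.
  apply: eq_bigr => z _; have [->|qz] := eqVneq (q z) 0.
    by rewrite !mul0r subrr big1// => j _; rewrite mul0r.
  rewrite -mulrBr -mulr_sumr; congr (_ * _).
  rewrite ln_prod//; last exact: qn.
  rewrite /chn ln_prod; last by move=> j; rewrite ffunE.
  rewrite -sumrB; apply: eq_bigr => j _.
  by rewrite ffunE ln_div ?posrE// qn.
under [in RHS]eq_bigr => z _ do (under eq_bigr do rewrite mulr_suml).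
rewrite exchange_big/=.
transitivity (\sum_j \sum_i u i * \sum_z Q (x i j) z * ln (Qb z / Q o z)).
  rewrite [RHS]exchange_big/= [LHS]mulr_sumr.
  under [LHS]eq_bigr do rewrite mulrA Qbe mulr_suml.
  rewrite [LHS]exchange_big/=; apply: eq_bigr => i _; rewrite -mulr_sumr.
  under [LHS]eq_bigr do rewrite -mulrA mulr_suml.
  by rewrite -mulr_sumr exchange_big.
apply: eq_bigr => j _; rewrite exchange_big/=; apply: eq_bigr => i _.
under [in RHS]eq_bigr do rewrite -mulrA.
rewrite -mulr_sumr; congr (_ * _); apply/esym.
apply: (@sum_prod_letter R _ Z (fun k => Q (x i k)) j (fun t => ln (Qb t / Q o t))) => k.
exact: (pQ _).2.
Qed.

End BroadcastConverse.

(** * Chi-square bound on the warden's divergence, and the rate it allows *)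

Section CovertRate.
Variables (R : realType) (K : nat) (Z : finType) (Q : 'I_K.+1 -> Z -> R).
Hypothesis pQ : forall x, is_pmf (Q x).
Hypothesis Q0_gt0 : forall z, 0 < Q ord0 z.
Hypothesis nonredundant : ~ (exists p : 'I_K -> R, is_pmf p /\
  forall z, Q ord0 z = \sum_(k < K) p k * Q (lift ord0 k) z).

Lemma KLxx (T : finType) (p : T -> R) : KL p p = 0.
Proof. by rewrite /KL big1// => t h; rewrite divff// ln1 mulr0. Qed.

(** This is how nonredundancy enters: a vanishing chi-square would express [Q ord0] as a mixture of
    the other rows. It keeps the denominator in [Lstar] positive. *)
Lemma chi2_gt0 (p : 'I_K -> R) : is_pmf p ->
  0 < chi2 (fun z => \sum_(k < K) p k * Q (lift ord0 k) z) (Q ord0).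
Proof.
move=> pp; have t0 z : 0 <=
    (\sum_(k < K) p k * Q (lift ord0 k) z - Q ord0 z) ^+ 2 / Q ord0 z.
  by rewrite divr_ge0 ?sqr_ge0// ltW.
rewrite lt_neqAle eq_sym sumr_ge0// andbT; apply/negP => /eqP e.
apply: nonredundant; exists p; split=> // z; apply/eqP; rewrite eq_sym -subr_eq0.
apply/negPn/negP => h; move: e; apply/eqP.
apply: (@sum_neq0 _ _ _ z) => //.
by apply: mulf_neq0; [rewrite expf_eq0|rewrite invr_eq0 gt_eqF].
Qed.

Section Receiver.
Variables (T : finType) (V : 'I_K.+1 -> T -> R).
Hypothesis L0 : 0 < Lstar V Q.

(** A set without a supremum has [sup] equal to 0, so positivity of [Lstar] yields nonemptiness and
    boundedness at once. *)
Lemma Lstar_has_sup : has_sup [set v | exists p : 'I_K -> R, is_pmf p /\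
  v = Num.sqrt (2 * (\sum_(k < K) p k * KL (V (lift ord0 k)) (V ord0)) ^+ 2
         / chi2 (fun z => \sum_(k < K) p k * Q (lift ord0 k) z) (Q ord0))].
Proof.
by apply: contrapT => /sup_out; move: L0; rewrite /Lstar => + e; rewrite e ltxx.
Qed.

Lemma Lstar_ge (p : 'I_K -> R) : is_pmf p ->
  2 * (\sum_(k < K) p k * KL (V (lift ord0 k)) (V ord0)) ^+ 2 <=
  Lstar V Q ^+ 2 *
    chi2 (fun z => \sum_(k < K) p k * Q (lift ord0 k) z) (Q ord0).
Proof.
move=> pp; have c0 := chi2_gt0 pp; rewrite -ler_pdivrMr//.
set v := _ / _; have v0 : 0 <= v.
  by apply: divr_ge0; [apply: mulr_ge0; rewrite ?sqr_ge0|exact: ltW].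
rewrite -(sqr_sqrtr v0) ler_sqr ?nnegrE ?sqrtr_ge0 ?(ltW L0)//.
by apply: ub_le_sup; [case: Lstar_has_sup|exists p].
Qed.

(** The divergence bound [u] becomes a chi-square bound in two passes: a crude one, then a sharp one
    whose correction is of order sqrt(u) and vanishes when [u = delta / n]. Then [Lstar] converts
    chi-square into rate. *)
Lemma covert_rate (Pb : 'I_K.+1 -> R) (u C : R) : is_pmf Pb -> 0 <= u ->
  (forall z, (Q ord0 z)^-1 <= C) ->
  \sum_z (\sum_x Pb x * Q x z) * ln ((\sum_x Pb x * Q x z) / Q ord0 z) <= u ->
  \sum_x Pb x * KL (V x) (V ord0) <=
  Lstar V Q * Num.sqrt (u * (1 + Num.sqrt (2 * C * (1 + C) * u))).
Proof.
move=> pPb u0 hC; set Qb := fun z => \sum_x Pb x * Q x z => hu.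
have Qb0 z : 0 <= Qb z.
  by apply: sumr_ge0 => x _; rewrite mulr_ge0 ?(pPb).1 ?(pQ x).1.
have Qb1 : \sum_z Qb z = 1.
  rewrite exchange_big/= -[RHS]pPb.2; apply: eq_bigr => x _.
  by rewrite -mulr_sumr (pQ x).2 mulr1.
have Qble z : Qb z <= 1.
  by rewrite -Qb1 (bigD1 z)//= lerDl sumr_ge0.
have Q0n z : Q ord0 z != 0 by rewrite gt_eqF.
have Q0V z : 0 < (Q ord0 z)^-1 by rewrite invr_gt0.
pose y z := Qb z / Q ord0 z.
pose X2 := \sum_z Q ord0 z * (y z - 1) ^+ 2.
have y0 z : 0 <= y z by rewrite divr_ge0// ltW.
have X20 : 0 <= X2.
  by apply: sumr_ge0 => z _; rewrite mulr_ge0 ?sqr_ge0// ltW.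
(* Any uniform upper bound on the likelihood ratio [y] turns the divergence into a chi-square bound,
   with loss [1 + a]. *)
have key a : 0 <= a -> (forall z, y z <= 1 + a) -> X2 <= 2 * (1 + a) * u.
  move=> a0 ya; have a1 : 0 < 2 * (1 + a) by lra.
  rewrite mulrC -ler_pdivrMr//; apply: le_trans hu.
  have -> : \sum_z Qb z * ln (Qb z / Q ord0 z) =
      \sum_z Q ord0 z * (xlnx (y z) - (y z - 1)).
    transitivity (\sum_z (Qb z * ln (Qb z / Q ord0 z) - (Qb z - Q ord0 z))).
      by rewrite [RHS]sumrB sumrB Qb1 (pQ ord0).2 subrr subr0.
    apply: eq_bigr => z _; rewrite /xlnx /y.
    by set l := ln _; field.
  rewrite /X2 mulr_suml; apply: ler_sum => z _; rewrite -mulrA.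
  apply: ler_wpM2l; first exact: ltW.
  by apply: xlnx_quad_ge => //; rewrite y0 ya.
have yC z : y z <= C.
  by rewrite /y; apply: le_trans (hC z); rewrite ler_piMl// ltW.
case: (pselect (exists z : Z, True)) => [[z0 _]|noz]; last first.
  by have := (pQ ord0).2; rewrite big1 => [/esym/eqP|z]; [rewrite oner_eq0|case: noz; exists z].
have C0 : 0 < C by apply: lt_le_trans (hC z0).
have X2C : X2 <= 2 * (1 + C) * u.
  by apply: key => [|z]; [exact: ltW|apply: le_trans (yC z) _; rewrite lerDr].
(* The crude pass [X2C] bounds each single term of [X2], hence [y z - 1] by this [a]; feeding it
   back into [key] is the sharp pass. *)
set a := Num.sqrt (2 * C * (1 + C) * u).
have X2a : X2 <= 2 * (1 + a) * u.
  apply: key => [|z]; first exact: sqrtr_ge0.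
  rewrite -lerBlDl; apply: le_trans (ler_norm _) _.
  rewrite -sqrtr_sqr; apply: ler_wsqrtr.
  have h1 : Q ord0 z * (y z - 1) ^+ 2 <= X2.
    rewrite /X2 (bigD1 z)//= lerDl sumr_ge0// => z' _.
    by rewrite mulr_ge0 ?sqr_ge0// ltW.
  have h2 : (y z - 1) ^+ 2 <= (Q ord0 z)^-1 * X2.
    by rewrite -ler_pdivrMl ?invr_gt0// invrK.
  apply: le_trans h2 _; apply: le_trans (_ : C * X2 <= _).
    by rewrite ler_wpM2r.
  have := ler_wpM2l (ltW C0) X2C; lra.
set D := \sum_x _.
suff h : 2 * D ^+ 2 <= Lstar V Q ^+ 2 * X2.
  apply: le_trans (ler_norm _) _; rewrite -sqrtr_sqr.
  rewrite -[X in X * _]ger0_norm ?(ltW L0)// -[X in X * _]sqrtr_sqr.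
  rewrite -sqrtrM ?sqr_ge0//; apply: ler_wsqrtr.
  have := ler_wpM2l (sqr_ge0 (Lstar V Q)) X2a; lra.
have DE : D = \sum_(k < K) Pb (lift ord0 k) * KL (V (lift ord0 k)) (V ord0).
  by rewrite /D big_ord_recl KLxx mulr0 add0r.
(* Condition [Pb] on the nonzero letters. The divergence [D] scales with [al] and the chi-square
   with [al ^+ 2], so the ratio defining [Lstar] is unaffected by the mass on 0. *)
pose al := \sum_(k < K) Pb (lift ord0 k).
have al0 : 0 <= al by apply: sumr_ge0 => k _; apply: pPb.1.
have Pb0 : Pb ord0 = 1 - al by rewrite -pPb.2 big_ord_recl /al addrK.
have [ale|aln] := eqVneq al 0.
  have Pbk k : Pb (lift ord0 k) = 0.
    apply/eqP/negPn/negP => h; move/eqP: ale; apply/negP.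
    by apply: (@sum_neq0 _ _ _ k) => // k'; apply: pPb.1.
  rewrite DE big1 => [|k _]; last by rewrite Pbk mul0r.
  by rewrite expr0n/= mulr0 mulr_ge0// sqr_ge0.
pose p k := Pb (lift ord0 k) / al.
have pp : is_pmf p.
  split=> [k|]; first by rewrite divr_ge0// pPb.1.
  by rewrite -mulr_suml divff.
have := Lstar_ge pp.
have -> : \sum_(k < K) p k * KL (V (lift ord0 k)) (V ord0) = D / al.
  by rewrite DE mulr_suml; apply: eq_bigr => k _; rewrite mulrAC.
have -> : chi2 (fun z => \sum_(k < K) p k * Q (lift ord0 k) z) (Q ord0) = X2 / al ^+ 2.
  rewrite /chi2 /X2 mulr_suml; apply: eq_bigr => z _.
  have -> : \sum_(k < K) p k * Q (lift ord0 k) z = (Qb z - (1 - al) * Q ord0 z) / al.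
    rewrite /Qb big_ord_recl Pb0 addrAC subrr add0r mulr_suml.
    by apply: eq_bigr => k _; rewrite mulrAC.
  by rewrite /y; field; rewrite aln Q0n.
rewrite expr_div_n !mulrA ler_pM2r// invr_gt0 exprn_gt0//.
by rewrite lt_neqAle eq_sym aln.
Qed.

End Receiver.

Lemma avg3_pair M1 M2 Ks (F : 'I_M1 -> 'I_M2 -> 'I_Ks -> R) :
  avg3 F = \sum_(t : 'I_M1 * 'I_M2 * 'I_Ks)
    ((M1 * M2 * Ks)%N%:R)^-1 * F t.1.1 t.1.2 t.2.
Proof.
rewrite /avg3 pair_big/= (pair_big xpredT xpredT (fun u s => F u.1 u.2 s))/=.
by rewrite mulr_sumr.
Qed.

Lemma converse_finite (Y1 Y2 : finType) (W : 'I_K.+1 -> Y1 -> R) (V : 'I_K.+1 -> Y2 -> R)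
    (c C delta e : R) n M1 M2 Ks (f : 'I_M1 -> 'I_M2 -> 'I_Ks -> {ffun 'I_n -> 'I_K.+1})
    (d1 : {ffun 'I_n -> Y1} -> 'I_Ks -> 'I_M1)
    (d2 : {ffun 'I_n -> Y2} -> 'I_Ks -> 'I_M2) :
  (forall x, is_pmf (W x)) -> (forall x, is_pmf (V x)) ->
  (forall x y, V ord0 y = 0 -> V x y = 0) -> 1 <= c ->
  (forall r, (forall x, 0 <= r x) -> mutinf W r <= c * mutinf V r) ->
  0 < Lstar V Q -> (forall z, (Q ord0 z)^-1 <= C) -> 0 <= delta ->
  (0 < n)%N -> (0 < M1)%N -> (0 < M2)%N -> (0 < Ks)%N ->
  KL (fun z => avg3 (fun w1 w2 s => chn Q (f w1 w2 s) z)) (chn Q [ffun=> ord0])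
    <= delta ->
  avg3 (fun w1 w2 s => \sum_y chn W (f w1 w2 s) y * (d1 y s != w1)%:R) <= e ->
  avg3 (fun w1 w2 s => \sum_y chn V (f w1 w2 s) y * (d2 y s != w2)%:R) <= e ->
  (1 - e) * (ln M1%:R + c * ln M2%:R) - (1 + c) * ln 2 <=
  c * (Lstar V Q * Num.sqrt (n%:R * delta *
         (1 + Num.sqrt (2 * C * (1 + C) * (delta / n%:R))))).
Proof.
move=> pW pV ac c1 hc L0 hC delta0 n0 M10 M20 K0 hKL he1 he2.
have np : 0 < n%:R :> R by rewrite ltr0n.
have nn : n%:R != 0 :> R by rewrite gt_eqF.
pose I := ('I_M1 * 'I_M2 * 'I_Ks)%type.
pose u : R := ((M1 * M2 * Ks)%N%:R)^-1.
have Mp : 0 < (M1 * M2 * Ks)%N%:R :> R by rewrite ltr0n !muln_gt0 M10 M20.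
have u0 : 0 < u by rewrite invr_gt0.
have u1 : \sum_(t : I) u = 1.
  by rewrite sumr_const !card_prod !card_ord -mulr_natl mulfV// gt_eqF.
pose x (t : I) := f t.1.1 t.1.2 t.2.
pose Pb a : R := n%:R^-1 * \sum_(t : I) u * \sum_i (x t i == a)%:R.
(* Both uses of the average type are linear in it: with [G] a column of [Q] this feeds
   [covert_converse], with [G] the receiver's divergence it rewrites the right side of
   [broadcast_converse]. *)
have PbE (G : 'I_K.+1 -> R) :
    n%:R * \sum_a Pb a * G a = \sum_(t : I) u * \sum_i G (x t i).
  rewrite mulr_sumr /Pb.
  transitivity (\sum_a \sum_(t : I) u * \sum_i (x t i == a)%:R * G a).
    apply: eq_bigr => a _; rewrite !mulrA mulfV// mul1r mulr_suml.
    by apply: eq_bigr => t _; rewrite -mulrA mulr_suml.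
  rewrite exchange_big/=; apply: eq_bigr => t _; rewrite -mulr_sumr; congr (_ * _).
  rewrite exchange_big/=; apply: eq_bigr => i _.
  rewrite (bigD1 (x t i))//= eqxx mul1r big1 ?addr0// => a.
  by rewrite eq_sym => /negPf ->; rewrite mul0r.
have pPb : is_pmf Pb.
  split=> [a|].
    rewrite mulr_ge0 ?invr_ge0 ?ler0n// sumr_ge0// => t _.
    by rewrite mulr_ge0 ?(ltW u0)// sumr_ge0// => i _; rewrite ler0n.
  apply: (mulfI nn); rewrite mulr1 -(eq_bigr _ (fun a _ => mulr1 (Pb a))).
  rewrite (PbE (fun=> 1)); under eq_bigr do rewrite sumr_const card_ord.
  by rewrite -mulr_suml u1 mul1r.
have rate : n%:R * (\sum_z (\sum_a Pb a * Q a z) *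
    ln ((\sum_a Pb a * Q a z) / Q ord0 z)) <= delta.
  apply: le_trans hKL.
  have := @covert_converse R _ _ Q ord0 n I (fun=> u) x
    (fun z => \sum_a Pb a * Q a z) pQ Q0_gt0 (fun=> u0) u1.
  move=> /(_ (fun z => PbE (Q^~ z))) h; apply: le_trans h _.
  rewrite le_eqVlt; apply/orP; left; apply/eqP; congr KL.
  by apply/funext => z; rewrite avg3_pair.
have {}rate : \sum_z (\sum_a Pb a * Q a z) *
    ln ((\sum_a Pb a * Q a z) / Q ord0 z) <= delta / n%:R.
  by rewrite ler_pdivlMr// mulrC.
have dn0 : 0 <= delta / n%:R by rewrite divr_ge0 ?ler0n.
have := covert_rate L0 pPb dn0 hC rate.
set a := 1 + _ => cr.
have := broadcast_converse f d1 d2 pW pV ac c1 hc M10 M20 K0.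
set e1 := avg3 _ in he1 *; set e2 := avg3 _ in he2 *.
have -> : avg3 (fun w1 w2 s => \sum_i KL (V (f w1 w2 s i)) (V ord0)) =
    n%:R * \sum_a Pb a * KL (V a) (V ord0).
  by rewrite avg3_pair (PbE (fun a => KL (V a) (V ord0))).
move=> h.
have -> : Num.sqrt (n%:R * delta * a) = n%:R * Num.sqrt (delta / n%:R * a).
  rewrite -[X in X * Num.sqrt _]ger0_norm ?ler0n// -sqrtr_sqr -sqrtrM ?sqr_ge0//.
  by congr Num.sqrt; field.
have c0 : 0 <= c by lra.
have := ler_wpM2l c0 (ler_wpM2l (ltW np) cr).
have l1 : 0 <= ln M1%:R :> R by rewrite ln_ge0// ler1n.
have l2 : 0 <= ln M2%:R :> R by rewrite ln_ge0// ler1n.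
have h1 := ler_wpM2r l1 he1.
have h2 := ler_wpM2r (mulr_ge0 c0 l2) he2.
move: h; lra.
Qed.

End CovertRate.

(** * Asymptotics of the converse *)

Section Asymptotics.
Variable R : realType.

Lemma near_lt_of_limn_einf (u : nat -> R) (l tau : R) : 0 < tau ->
  (l%:E <= limn_einf (fun n => (u n)%:E))%E ->
  \forall n \near \oo, l - tau < u n.
Proof.
move=> t0; rewrite /limn_einf /limn_esup /limf_esup leeNr -EFinN => h.
have /ereal_inf_lt[_ [A FA <-] sA] : (ereal_inf
    [set ereal_sup [set (- (u x)%:E)%E | x in A] | A in \oo] < (- l + tau)%:E)%E.
  by apply: le_lt_trans h _; rewrite lte_fin ltrDl.
apply: filterS FA => n An.
have : ((- (u n)%:E) < (- l + tau)%:E)%E.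
  by apply: le_lt_trans sA; apply: ereal_sup_ubound; exists n.
by rewrite -EFinN lte_fin; lra.
Qed.

Lemma near_gt_of_limn_esup (u : nat -> R) (l tau : R) : 0 < tau ->
  (limn_esup (fun n => (u n)%:E) <= l%:E)%E ->
  \forall n \near \oo, u n < l + tau.
Proof.
move=> t0; rewrite /limn_esup /limf_esup => h.
have /ereal_inf_lt[_ [A FA <-] sA] : (ereal_inf
    [set ereal_sup [set (u x)%:E | x in A] | A in \oo] < (l + tau)%:E)%E.
  by apply: le_lt_trans h _; rewrite lte_fin ltrDl.
apply: filterS FA => n An; rewrite -lte_fin.
by apply: le_lt_trans sA; apply: ereal_sup_ubound; exists n.
Qed.

Lemma limn_einf_ge_of_near (u : nat -> R) (l : R) :
  (\forall n \near \oo, l <= u n) -> (l%:E <= limn_einf (fun n => (u n)%:E))%E.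
Proof.
move=> h; rewrite /limn_einf /limn_esup /limf_esup leeNr -EFinN.
apply: le_trans (ereal_inf_lbound _) _; first by exists [set n | l <= u n].
by apply: ge_ereal_sup => _ [n /= lu <-]; rewrite lee_fin lerN2.
Qed.

Lemma limn_esup_le_of_near (u : nat -> R) (l : R) :
  (\forall n \near \oo, u n <= l) -> (limn_esup (fun n => (u n)%:E) <= l%:E)%E.
Proof.
move=> h; rewrite /limn_esup /limf_esup.
apply: le_trans (ereal_inf_lbound _) _; first by exists [set n | u n <= l].
by apply: ge_ereal_sup => _ [n /= lu <-]; rewrite lee_fin.
Qed.

Lemma near_sqrt_ge (A : R) : \forall n \near \oo, A <= Num.sqrt n%:R :> R.
Proof.
near=> n; apply: le_trans (ler_norm _) _; rewrite -sqrtr_sqr; apply: ler_wsqrtr.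
by near: n; exact: nbhs_infty_ger.
Unshelve. all: by end_near. Qed.

(** After division by sqrt(n delta) all corrections are within a prescribed [tau] for large n, and a
    strict violation by [g] leaves room for a positive [tau]. *)
Lemma converse_limit (M1 M2 : nat -> nat) (e : nat -> R) (c L k eps delta L1 L2 : R) :
  (forall n, (0 < M1 n)%N) -> (forall n, (0 < M2 n)%N) ->
  0 <= c -> 0 <= L -> 0 <= k -> 0 < delta -> 0 <= eps < 1 -> 0 <= L1 -> 0 <= L2 ->
  (forall n, (0 < n)%N ->
    (1 - e n) * (ln (M1 n)%:R + c * ln (M2 n)%:R) - (1 + c) * ln 2 <=
    c * (L * Num.sqrt (n%:R * delta * (1 + Num.sqrt (k * (delta / n%:R)))))) ->
  (L1%:E <= limn_einf (fun n => (ln (M1 n)%:R / Num.sqrt (n%:R * delta))%:E))%E ->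
  (L2%:E <= limn_einf (fun n => (ln (M2 n)%:R / Num.sqrt (n%:R * delta))%:E))%E ->
  (limn_esup (fun n => (e n)%:E) <= eps%:E)%E ->
  (1 - eps) * (L1 + c * L2) <= c * L.
Proof.
move=> M10 M20 c0 L0 k0 d0 /andP[eps0 eps1] L10 L20 hn h1 h2 he.
rewrite leNgt; apply/negP => gap.
set S := L1 + c * L2 in gap.
have S0 : 0 <= S by rewrite addr_ge0 ?mulr_ge0.
(* [B] dominates the coefficient of [tau] in the expanded final inequality, which [tau * B <= g / 2]
   then contradicts; the other bound on [tau] keeps [1 - eps - tau] positive. *)
pose B := c * L + 1 + S + 1 + c.
have cL0 : 0 <= c * L by rewrite mulr_ge0.
have B0 : 0 < B by rewrite /B; lra.
pose g := (1 - eps) * S - c * L.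
have g0 : 0 < g by rewrite /g; lra.
pose tau := Num.min ((1 - eps) / 2) (g / (2 * B)).
have tau0 : 0 < tau by rewrite lt_min !divr_gt0 ?mulr_gt0//; lra.
have tau1 : tau <= (1 - eps) / 2 by rewrite ge_min lexx.
have tau2 : tau * B <= g / 2.
  rewrite -ler_pdivlMr//; apply: le_trans (_ : g / (2 * B) <= _).
    by rewrite ge_min lexx orbT.
  by rewrite invfM mulrA.
have sd0 : 0 < Num.sqrt delta by rewrite sqrtr_gt0.
near \oo => n.
have n1 : 1 <= Num.sqrt n%:R :> R by near: n; exact: near_sqrt_ge.
have sn0 : 0 < Num.sqrt n%:R :> R by lra.
have n0 : (0 < n)%N by move: sn0; rewrite sqrtr_gt0 ltr0n.
have nk : Num.sqrt (k * delta) / tau <= Num.sqrt n%:R :> R.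
  by near: n; exact: near_sqrt_ge.
have nl : (1 + c) * ln 2 / Num.sqrt delta / tau <= Num.sqrt n%:R :> R.
  by near: n; exact: near_sqrt_ge.
have a1 : L1 - tau < ln (M1 n)%:R / Num.sqrt (n%:R * delta).
  by near: n; exact: near_lt_of_limn_einf.
have a2 : L2 - tau < ln (M2 n)%:R / Num.sqrt (n%:R * delta).
  by near: n; exact: near_lt_of_limn_einf.
have ae : e n < eps + tau by near: n; exact: near_gt_of_limn_esup.
have := hn n n0; set s := Num.sqrt (n%:R * delta) in a1 a2 *.
have sE : s = Num.sqrt n%:R * Num.sqrt delta by rewrite /s sqrtrM ?ler0n.
have s0 : 0 < s by rewrite sE mulr_gt0.
have kn : Num.sqrt (k * (delta / n%:R)) <= tau.
  rewrite mulrA sqrtrM ?mulr_ge0 ?(ltW d0)// sqrtrV ?ler0n//.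
  by move: nk; rewrite !ler_pdivrMr// [_ * tau]mulrC.
have nd0 : 0 <= n%:R * delta by rewrite mulr_ge0 ?ler0n ?ltW.
rewrite sqrtrM// -/s.
set r := Num.sqrt (1 + _); have r1 : r <= 1 + tau.
  have t1 : 0 <= 1 + tau by lra.
  rewrite -[leRHS]ger0_norm// -sqrtr_sqr; apply: ler_wsqrtr.
  have := sqrtr_ge0 (k * (delta / n%:R)); move: kn; nra.
have l1 : 0 <= ln (M1 n)%:R :> R by rewrite ln_ge0// ler1n.
have l2 : 0 <= ln (M2 n)%:R :> R by rewrite ln_ge0// ler1n.
have nl' : (1 + c) * ln 2 <= tau * s.
  move: nl; rewrite !ler_pdivrMr// sE; lra.
have {}a1 : (L1 - tau) * s <= ln (M1 n)%:R by rewrite -ler_pdivlMr// ltW.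
have {}a2 : (L2 - tau) * s <= ln (M2 n)%:R by rewrite -ler_pdivlMr// ltW.
have a3 : (S - tau * (1 + c)) * s <= ln (M1 n)%:R + c * ln (M2 n)%:R.
  have := ler_wpM2l c0 a2; rewrite /S; lra.
have e1 : 0 < 1 - eps - tau by lra.
have a4 : (1 - eps - tau) * ((S - tau * (1 + c)) * s) <=
    (1 - e n) * (ln (M1 n)%:R + c * ln (M2 n)%:R).
  apply: le_trans (ler_wpM2l (ltW e1) a3) _.
  rewrite ler_wpM2r//; first by rewrite addr_ge0 ?mulr_ge0.
  by lra.
move=> fin.
have a5 : c * (L * (s * r)) <= c * L * (1 + tau) * s.
  rewrite -!mulrA ler_wpM2l// ler_wpM2l// mulrC ler_wpM2r//.
  exact: ltW.
have : ((1 - eps - tau) * (S - tau * (1 + c)) - tau) * s <= c * L * (1 + tau) * s.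
  rewrite mulrBl -mulrA; lra.
rewrite ler_pM2r//.
have x1 : 0 <= tau * tau * (1 + c) by rewrite !mulr_ge0//; lra.
have x2 : 0 <= tau * (1 + c) * eps by rewrite !mulr_ge0//; lra.
by move: tau2 g0; rewrite /B /g; lra.
Unshelve. all: by end_near. Qed.

End Asymptotics.

(** * Converse for the capacity region *)

Section Region.
Variables (R : realType) (K : nat) (Y1 Y2 Z : finType).
Variable P : 'I_K.+1 -> Y1 -> Y2 -> Z -> R.
Hypothesis chP : is_channel P.

Lemma mutinf_MI (T : finType) (PX : 'I_K.+1 -> R) (Wc : 'I_K.+1 -> T -> R) :
  is_pmf PX -> (forall x, is_pmf (Wc x)) -> MI PX Wc = mutinf Wc PX.
Proof.
move=> pPX pW; rewrite /MI KLE /mutinf pPX.2 xlnx1 addr0.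
rewrite -(pair_big xpredT xpredT (fun x y => PX x * Wc x y *
  ln (PX x * Wc x y / (PX x * \sum_x' PX x' * Wc x' y))))/=.
have -> : \sum_b xlnx (\sum_a PX a * Wc a b) =
    \sum_a \sum_b PX a * Wc a b * ln (\sum_a PX a * Wc a b).
  by rewrite exchange_big/=; apply: eq_bigr => b _; rewrite /xlnx mulr_suml.
rewrite -sumrB; apply: eq_bigr => x _; rewrite mulr_sumr -sumrB.
apply: eq_bigr => y _.
have PX0 : 0 <= PX x by apply: pPX.1.
have W0 : 0 <= Wc x y by apply: (pW x).1.
have [->|nP] := eqVneq (PX x) 0; first by rewrite !mul0r subrr.
have [->|nW] := eqVneq (Wc x y) 0; first by rewrite xlnx0 !(mulr0, mul0r) subrr.
set q := \sum_x' _; have q0 : 0 < q.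
  rewrite lt_neqAle eq_sym; apply/andP; split.
    apply: (@sum_neq0 _ _ _ x) => [x'|]; last exact: mulf_neq0.
    by rewrite mulr_ge0 ?pPX.1 ?(pW x').1.
  by apply: sumr_ge0 => x' _; rewrite mulr_ge0 ?pPX.1 ?(pW x').1.
have Wp : 0 < Wc x y by rewrite lt_neqAle eq_sym nW.
rewrite -mulf_div divff// mul1r ln_div ?posrE//.
by rewrite /xlnx; ring.
Qed.

(** The ratio condition speaks of probability laws; homogeneity ([mutinfZ]) carries it to the
    unnormalised measures that conditioning produces in the tensorisation. *)
Lemma mutinf_le_of_MI (T1 T2 : finType) (W : 'I_K.+1 -> T1 -> R)
    (V : 'I_K.+1 -> T2 -> R) (a b : R) :
  (forall x, is_pmf (W x)) -> (forall x, is_pmf (V x)) -> 0 < a -> 0 < b ->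
  (forall PX, is_pmf PX -> MI PX W * b <= a * MI PX V) ->
  forall r, (forall x, 0 <= r x) -> mutinf W r <= a / b * mutinf V r.
Proof.
move=> pW pV a0 b0 h r r0.
have [s0|sn] := eqVneq (\sum_x r x) 0.
  have e x : r x = 0.
    apply/eqP/negPn/negP => rx; move/eqP: s0; apply/negP.
    exact: (@sum_neq0 _ _ _ x).
  have -> : r = fun=> 0 by apply/funext.
  have z (T : finType) (U : 'I_K.+1 -> T -> R) : mutinf U (fun=> 0) = 0.
    rewrite /mutinf big1 => [|x _]; last by rewrite mul0r.
    rewrite big1 ?big1 ?xlnx0 ?subrr ?addr0// => y _.
    by rewrite big1 ?xlnx0// => x _; rewrite mul0r.
  by rewrite !z mulr0.
set s := \sum_x r x in sn; have s0 : 0 < s by rewrite lt_neqAle eq_sym sn sumr_ge0.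
pose p x := r x / s.
have pp : is_pmf p.
  by split=> [x|]; [rewrite divr_ge0// ltW|rewrite -mulr_suml divff].
have -> : r = fun x => s * p x by apply/funext => x; rewrite mulrC divfK.
rewrite (mutinfZ (ltW s0) pp.1 pW) (mutinfZ (ltW s0) pp.1 pV).
rewrite mulrCA ler_pM2l// -!mutinf_MI//.
by have := h p pp; rewrite -ler_pdivlMr// mulrAC.
Qed.

Lemma chW_pmf x : is_pmf (chW P x).
Proof.
have [P0 P1] := chP x; split=> [y|]; last exact: P1.
by apply: sumr_ge0 => y2 _; apply: sumr_ge0.
Qed.

Lemma chV_pmf x : is_pmf (chV P x).
Proof.
have [P0 P1] := chP x; split=> [y|].
  by apply: sumr_ge0 => y1 _; apply: sumr_ge0.
by rewrite -P1 exchange_big.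
Qed.

Lemma chQ_pmf x : is_pmf (chQ P x).
Proof.
have [P0 P1] := chP x; split=> [z|].
  by apply: sumr_ge0 => y1 _; apply: sumr_ge0.
rewrite -P1 exchange_big/=; apply: eq_bigr => y1 _.
by rewrite exchange_big.
Qed.

Lemma chY12_ge0 x y1 y2 : 0 <= chY12 P x y1 y2.
Proof. by apply: sumr_ge0 => z _; apply: (chP x).1. Qed.

Lemma sum_chY12r n (x : {ffun 'I_n -> 'I_K.+1}) (y1 : {ffun 'I_n -> Y1}) :
  \sum_(y2 : {ffun 'I_n -> Y2}) \prod_i chY12 P (x i) (y1 i) (y2 i) =
  chn (chW P) x y1.
Proof. by rewrite (sum_prod_ffun (fun i y2 => chY12 P (x i) (y1 i) y2)). Qed.

Lemma sum_chY12l n (x : {ffun 'I_n -> 'I_K.+1}) (y2 : {ffun 'I_n -> Y2}) :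
  \sum_(y1 : {ffun 'I_n -> Y1}) \prod_i chY12 P (x i) (y1 i) (y2 i) =
  chn (chV P) x y2.
Proof. by rewrite (sum_prod_ffun (fun i y1 => chY12 P (x i) y1 (y2 i))). Qed.

Local Notation encoder c := (@enc K Y1 Y2 _ c).
Local Notation decoder1 c := (@dec1 K Y1 Y2 _ c).
Local Notation decoder2 c := (@dec2 K Y1 Y2 _ c).

Definition err1 n (c : @code K Y1 Y2 n) : R :=
  avg3 (fun w1 w2 s => \sum_y chn (chW P) (encoder c w1 w2 s) y * (decoder1 c y s != w1)%:R).

Definition err2 n (c : @code K Y1 Y2 n) : R :=
  avg3 (fun w1 w2 s => \sum_y chn (chV P) (encoder c w1 w2 s) y * (decoder2 c y s != w2)%:R).

Lemma err1_le n (c : code K Y1 Y2 n) : err1 c <= err_prob P c.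
Proof.
apply: avg3_le => w1 w2 s; apply: ler_sum => y1 _.
rewrite -sum_chY12r mulr_suml; apply: ler_sum => y2 _.
rewrite ler_wpM2l ?prodr_ge0// => [i _|]; first exact: chY12_ge0.
by rewrite ler_nat; case: (_ != _) => //=; case: (_ != _).
Qed.

Lemma err2_le n (c : code K Y1 Y2 n) : err2 c <= err_prob P c.
Proof.
apply: avg3_le => w1 w2 s; rewrite [leRHS]exchange_big/=; apply: ler_sum => y2 _.
rewrite -sum_chY12l mulr_suml; apply: ler_sum => y1 _.
rewrite ler_wpM2l ?prodr_ge0// => [i _|]; first exact: chY12_ge0.
by rewrite ler_nat orbC; case: (_ != _) => //=; case: (_ != _).
Qed.

Lemma err_prob_le n (c : code K Y1 Y2 n) : err_prob P c <= err1 c + err2 c.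
Proof.
rewrite /err1 /err2 /avg3 -mulrDr ler_wpM2l ?invr_ge0 ?ler0n//.
rewrite -big_split/=; apply: ler_sum => w1 _.
rewrite -big_split/=; apply: ler_sum => w2 _.
rewrite -big_split/=; apply: ler_sum => s _.
have -> : \sum_y chn (chW P) (encoder c w1 w2 s) y * (decoder1 c y s != w1)%:R =
   \sum_(y1 : {ffun 'I_n -> Y1}) \sum_(y2 : {ffun 'I_n -> Y2})
     (\prod_i chY12 P (encoder c w1 w2 s i) (y1 i) (y2 i)) * (decoder1 c y1 s != w1)%:R.
  by apply: eq_bigr => y1 _; rewrite -sum_chY12r mulr_suml.
have -> : \sum_y chn (chV P) (encoder c w1 w2 s) y * (decoder2 c y s != w2)%:R =
   \sum_(y1 : {ffun 'I_n -> Y1}) \sum_(y2 : {ffun 'I_n -> Y2})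
     (\prod_i chY12 P (encoder c w1 w2 s i) (y1 i) (y2 i)) * (decoder2 c y2 s != w2)%:R.
  rewrite exchange_big/=.
  by apply: eq_bigr => y1 _; rewrite -sum_chY12l mulr_suml.
rewrite -big_split/=; apply: ler_sum => y1 _.
rewrite -big_split/=; apply: ler_sum => y2 _.
rewrite -mulrDr ler_wpM2l ?prodr_ge0// => [i _|]; first exact: chY12_ge0.
by rewrite -natrD ler_nat; case: (_ != _); case: (_ != _).
Qed.

Lemma warden_outE n (c : code K Y1 Y2 n) :
  @warden_out R K Y1 Y2 Z P n c =
  fun z => avg3 (fun w1 w2 s => chn (chQ P) (encoder c w1 w2 s) z).
Proof. by []. Qed.

Lemma Q0nE n : @Q0n R K Y1 Y2 Z P n = chn (chQ P) [ffun=> ord0].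
Proof.
by apply/funext => z; rewrite /Q0n /chn; apply: eq_bigr => i _; rewrite ffunE.
Qed.

Section ConverseRegion.
Hypothesis Q0_gt0 : forall z, 0 < chQ P ord0 z.
Hypothesis nonred : ~ (exists p : 'I_K -> R, is_pmf p /\
  forall z, chQ P ord0 z = \sum_(k < K) p k * chQ P (lift ord0 k) z).
Hypothesis acW : forall (k : 'I_K) y1, chW P ord0 y1 = 0 -> chW P (lift ord0 k) y1 = 0.
Hypothesis acV : forall (k : 'I_K) y2, chV P ord0 y2 = 0 -> chV P (lift ord0 k) y2 = 0.
Local Notation L1s := (Lstar (chW P) (chQ P)).
Local Notation L2s := (Lstar (chV P) (chQ P)).
Hypotheses (L1_gt0 : 0 < L1s) (L2_gt0 : 0 < L2s).

Lemma abscont_all (T : finType) (V : 'I_K.+1 -> T -> R) :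
  (forall (k : 'I_K) y, V ord0 y = 0 -> V (lift ord0 k) y = 0) ->
  forall x y, V ord0 y = 0 -> V x y = 0.
Proof. by move=> h x y V0; have [k ->|->//] := unliftP ord0 x; apply: h. Qed.

Lemma Q0V_bound : exists2 C : R, 0 <= C & forall z, (chQ P ord0 z)^-1 <= C.
Proof.
have V0 z : 0 <= (chQ P ord0 z)^-1 by rewrite invr_ge0 ltW.
exists (\sum_z (chQ P ord0 z)^-1) => [|z]; first exact: sumr_ge0.
by rewrite (bigD1 z)//= lerDl sumr_ge0.
Qed.

Lemma achievable_sum_le (eps delta : R) (L : R * R) :
  (if L2s <= L1s then
     forall PX : 'I_K.+1 -> R, is_pmf PX ->
       MI PX (chW P) * L2s <= L1s * MI PX (chV P)
   else
     forall PX : 'I_K.+1 -> R, is_pmf PX ->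
       MI PX (chV P) * L1s <= L2s * MI PX (chW P)) ->
  0 < delta -> 0 < eps < 1 -> achievable P eps delta L ->
  (1 - eps) * (L.1 / L1s + L.2 / L2s) <= 1.
Proof.
move=> hMI d0 /andP[eps0 eps1] [L10 [L20 [c [hKL [h1 [h2 he]]]]]].
have [C C0 hC] := Q0V_bound.
have k0 : 0 <= 2 * C * (1 + C) by rewrite !mulr_ge0//; lra.
have e01 : 0 <= eps < 1 by rewrite (ltW eps0).
have L1n : L1s != 0 by rewrite gt_eqF.
have L2n : L2s != 0 by rewrite gt_eqF.
move: hMI; case: ifP => [L21|/negbT]; [|rewrite -ltNge => L12] => hMI.
- have c1 : 1 <= L1s / L2s by rewrite ler_pdivlMr// mul1r.
  have := @converse_limit R (fun n => cM1 (c n)) (fun n => cM2 (c n))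
    (fun n => err_prob P (c n)) (L1s / L2s) L2s (2 * C * (1 + C)) eps delta L.1 L.2.
  move=> /(_ (fun n => cM1_gt0 (c n)) (fun n => cM2_gt0 (c n))).
  move=> /(_ (le_trans ler01 c1) (ltW L2_gt0) k0 d0 e01 L10 L20).
  suff hn : (forall n, (0 < n)%N ->
      (1 - err_prob P (c n)) * (ln (cM1 (c n))%:R + L1s / L2s * ln (cM2 (c n))%:R)
      - (1 + L1s / L2s) * ln 2 <=
      L1s / L2s * (L2s * Num.sqrt (n%:R * delta * (1 + Num.sqrt
        (2 * C * (1 + C) * (delta / n%:R)))))).
    move=> /(_ hn h1 h2 he); rewrite divfK// => h.
    rewrite -(ler_pM2r L1_gt0) mul1r; apply: le_trans h.
    by rewrite le_eqVlt; apply/orP; left; apply/eqP; field; rewrite L1n L2n.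
  move=> n n0; apply: (converse_finite chQ_pmf Q0_gt0 nonred chW_pmf chV_pmf
    (abscont_all acV) c1 _ L2_gt0 hC (ltW d0) n0 (cM1_gt0 _) (cM2_gt0 _)
    (cKey_gt0 (c n)) _ (err1_le (c n)) (err2_le (c n))).
  + exact: (mutinf_le_of_MI chW_pmf chV_pmf L1_gt0 L2_gt0 hMI).
  + by rewrite -warden_outE -Q0nE.
(* The same argument with the users exchanged; [avg3_swap] reorders the averages over the
   messages. *)
- have c1 : 1 <= L2s / L1s by rewrite ler_pdivlMr// mul1r ltW.
  have := @converse_limit R (fun n => cM2 (c n)) (fun n => cM1 (c n))
    (fun n => err_prob P (c n)) (L2s / L1s) L1s (2 * C * (1 + C)) eps delta L.2 L.1.
  move=> /(_ (fun n => cM2_gt0 (c n)) (fun n => cM1_gt0 (c n))).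
  move=> /(_ (le_trans ler01 c1) (ltW L1_gt0) k0 d0 e01 L20 L10).
  suff hn : (forall n, (0 < n)%N ->
      (1 - err_prob P (c n)) * (ln (cM2 (c n))%:R + L2s / L1s * ln (cM1 (c n))%:R)
      - (1 + L2s / L1s) * ln 2 <=
      L2s / L1s * (L1s * Num.sqrt (n%:R * delta * (1 + Num.sqrt
        (2 * C * (1 + C) * (delta / n%:R)))))).
    move=> /(_ hn h2 h1 he); rewrite divfK// => h.
    rewrite -(ler_pM2r L2_gt0) mul1r; apply: le_trans h.
    by rewrite le_eqVlt; apply/orP; left; apply/eqP; field; rewrite L1n L2n.
  move=> n n0.
  have E1 : avg3 (fun w2 w1 s => \sum_y chn (chW P) (encoder (c n) w1 w2 s) y *
      (decoder1 (c n) y s != w1)%:R) <= err_prob P (c n).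
    rewrite (@avg3_swap R _ _ _ (fun w1 w2 s => \sum_y chn (chW P)
      (encoder (c n) w1 w2 s) y * (decoder1 (c n) y s != w1)%:R)); exact: err1_le.
  have E2 : avg3 (fun w2 w1 s => \sum_y chn (chV P) (encoder (c n) w1 w2 s) y *
      (decoder2 (c n) y s != w2)%:R) <= err_prob P (c n).
    rewrite (@avg3_swap R _ _ _ (fun w1 w2 s => \sum_y chn (chV P)
      (encoder (c n) w1 w2 s) y * (decoder2 (c n) y s != w2)%:R)); exact: err2_le.
  apply: (converse_finite chQ_pmf Q0_gt0 nonred chV_pmf chW_pmf
    (abscont_all acW) c1 _ L1_gt0 hC (ltW d0) n0 (cM2_gt0 _) (cM1_gt0 _)
    (cKey_gt0 (c n)) _ E2 E1).
  + exact: (mutinf_le_of_MI chV_pmf chW_pmf L2_gt0 L1_gt0 hMI).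
  + apply: le_trans (hKL n); rewrite warden_outE Q0nE.
    rewrite le_eqVlt; apply/orP; left; apply/eqP; congr KL; apply/funext => z.
    exact: (@avg3_swap R _ _ _ (fun w1 w2 s => chn (chQ P) (encoder (c n) w1 w2 s) z)).
Qed.

Lemma closed_halfplane (a b d : R) : closed [set L : R * R | a * L.1 + b * L.2 <= d].
Proof.
apply: (@preimage_closed _ _ (fun L : R * R => a * L.1 + b * L.2) [set x | x <= d]).
  move=> L _; apply: cvgD.
    by apply: cvgM; [exact: cvg_cst|exact: cvg_fst].
  by apply: cvgM; [exact: cvg_cst|exact: cvg_snd].
exact: closed_le.
Qed.

Lemma region_subset (delta : R) (L : R * R) :
  (if L2s <= L1s then
     forall PX : 'I_K.+1 -> R, is_pmf PX ->
       MI PX (chW P) * L2s <= L1s * MI PX (chV P)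
   else
     forall PX : 'I_K.+1 -> R, is_pmf PX ->
       MI PX (chV P) * L1s <= L2s * MI PX (chW P)) ->
  0 < delta -> covert_capacity_region P delta L ->
  0 <= L.1 /\ 0 <= L.2 /\ L.1 / L1s + L.2 / L2s <= 1.
Proof.
move=> hMI d0 hL.
(* Each inequality of the region is a closed half-plane, so it survives the closure in [Lregion]. *)
have step (a b d eps : R) : 0 < eps < 1 ->
    (forall M, achievable P eps delta M -> a * M.1 + b * M.2 <= d) ->
    a * L.1 + b * L.2 <= d.
  move=> eps01 h.
  have : closure [set M : R * R | a * M.1 + b * M.2 <= d] L.
    by apply: closureS (hL eps eps01) => M /h.
  by rewrite -(closure_id _).1//; exact: closed_halfplane.
have half : 0 < (2^-1 : R) < 1 by apply/andP; split; lra.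
split.
  have := step (- 1) 0 0 _ half; rewrite mulN1r mul0r addr0 oppr_le0; apply.
  by move=> M [M0 _]; rewrite mulN1r mul0r addr0 oppr_le0.
split.
  have := step 0 (- 1) 0 _ half; rewrite mulN1r mul0r add0r oppr_le0; apply.
  by move=> M [_ [M0 _]]; rewrite mulN1r mul0r add0r oppr_le0.
have all_eps eps : 0 < eps < 1 -> (1 - eps) * (L.1 / L1s + L.2 / L2s) <= 1.
  move=> eps01; have := step ((1 - eps) / L1s) ((1 - eps) / L2s) 1 _ eps01.
  have E (M : R * R) : (1 - eps) / L1s * M.1 + (1 - eps) / L2s * M.2 =
      (1 - eps) * (M.1 / L1s + M.2 / L2s) by ring.
  by rewrite E; apply => M hM; rewrite E; apply: achievable_sum_le hM.
set S := _ + _ in all_eps *; rewrite leNgt; apply/negP => S1.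
have S0 : 0 < S by lra.
(* If [S > 1], this [eps] makes [(1 - eps) * S] the midpoint of 1 and [S], which still exceeds 1. *)
have := all_eps ((S - 1) / (2 * S)).
have -> : (1 - (S - 1) / (2 * S)) * S = (S + 1) / 2 by field; rewrite gt_eqF.
move=> /(_ _) h; suff : (S + 1) / 2 <= 1 by lra.
apply: h; apply/andP; split; first by rewrite divr_gt0 ?mulr_gt0//; lra.
by rewrite ltr_pdivrMr ?mulr_gt0//; lra.
Qed.

End ConverseRegion.
End Region.

(** * Random coding *)

Section Average.
Variable R : realType.
Implicit Types T C : finType.

Definition avg T (F : T -> R) : R := #|T|%:R^-1 * \sum_t F t.

Lemma avg_le T (F G : T -> R) : (forall t, F t <= G t) -> avg F <= avg G.
Proof. by move=> FG; rewrite ler_wpM2l ?invr_ge0 ?ler0n//; apply: ler_sum. Qed.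

Lemma avg_cst T (a : R) : (0 < #|T|)%N -> avg (fun _ : T => a) = a.
Proof.
move=> T0; rewrite /avg sumr_const -(mulr_natl a) mulKf//.
by rewrite pnatr_eq0 -lt0n.
Qed.

Lemma avg_le_cst T (F : T -> R) (a : R) : (0 < #|T|)%N -> (forall t, F t <= a) ->
  avg F <= a.
Proof. by move=> T0 h; rewrite -(avg_cst a T0); apply: avg_le. Qed.

Lemma avgZ T (F : T -> R) (a : R) : avg (fun t => a * F t) = a * avg F.
Proof. by rewrite /avg -mulr_sumr mulrCA. Qed.

Lemma avgD T (F G : T -> R) : avg (fun t => F t + G t) = avg F + avg G.
Proof. by rewrite /avg big_split/= mulrDr. Qed.

Lemma avg_sum T C (F : T -> C -> R) (D : pred C) :
  avg (fun t => \sum_(c | D c) F t c) = \sum_(c | D c) avg (F^~ c).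
Proof. by rewrite /avg exchange_big/= mulr_sumr. Qed.

Lemma avg_prod T C (F : T * C -> R) : avg F = avg (fun t => avg (fun c => F (t, c))).
Proof.
rewrite /avg card_prod natrM invfM -mulr_sumr mulrA pair_big/=.
by congr (_ * _); apply: eq_bigr => -[].
Qed.

Lemma avg_enum_val T (F : T -> R) : avg (fun i : 'I_#|T| => F (enum_val i)) = avg F.
Proof. by rewrite /avg card_ord -big_enum_val. Qed.

Lemma avg3_avg M1 M2 Ks (F : 'I_M1 -> 'I_M2 -> 'I_Ks -> R) :
  avg3 F = avg (fun w1 => avg (fun w2 => avg (F w1 w2))).
Proof.
rewrite /avg3 /avg !card_ord !natrM !invfM -!mulrA; congr (_ * _).
by rewrite -mulr_sumr; congr (_ * _); rewrite mulr_sumr; apply: eq_bigr => w1 _;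
   rewrite mulr_sumr.
Qed.

Lemma avg_ffun_prod n T (F : 'I_n -> T -> R) :
  avg (fun f : {ffun 'I_n -> T} => \prod_i F i (f i)) = \prod_i avg (F i).
Proof.
rewrite /avg (sum_prod_ffun F) card_ffun card_ord natrX.
by rewrite big_split/= prodr_const card_ord exprVn.
Qed.

Lemma avg_ffun1 n T (i : 'I_n) (F : T -> R) : (0 < #|T|)%N ->
  avg (fun f : {ffun 'I_n -> T} => F (f i)) = avg F.
Proof.
move=> T0; pose G j t := if j == i then F t else 1.
transitivity (avg (fun f : {ffun 'I_n -> T} => \prod_j G j (f j))).
  congr avg; apply/funext => f; rewrite (bigD1 i)//= big1 => [|j /negPf ji].
    by rewrite /G eqxx mulr1.
  by rewrite /G ji.
rewrite (avg_ffun_prod G) (bigD1 i)//= big1 => [|j /negPf ji].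
  by rewrite /G eqxx mulr1.
by rewrite /G ji avg_cst.
Qed.

(** Distinct codewords of a uniform codebook are independent; pairwise independence is what the
    false-alarm bound uses. *)
Lemma avg_ffun2 n T (i k : 'I_n) (F H : T -> R) : (0 < #|T|)%N -> k != i ->
  avg (fun f : {ffun 'I_n -> T} => F (f i) * H (f k)) = avg F * avg H.
Proof.
move=> T0 ki; pose G j t := if j == i then F t else if j == k then H t else 1.
transitivity (avg (fun f : {ffun 'I_n -> T} => \prod_j G j (f j))).
  congr avg; apply/funext => f; rewrite (bigD1 i)//= (bigD1 k)//= big1.
    by rewrite /G eqxx (negPf ki) eqxx mulr1.
  by move=> j /andP[/negPf ji /negPf jk]; rewrite /G ji jk.
rewrite (avg_ffun_prod G) (bigD1 i)//= (bigD1 k)//= big1.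
  by rewrite /G eqxx (negPf ki) eqxx mulr1.
by move=> j /andP[/negPf ji /negPf jk]; rewrite /G ji jk avg_cst.
Qed.

End Average.

Section RandomCode.
Variables (R : realType) (X Y : finType) (W : X -> Y -> R) (o : X).
Hypothesis pW : forall x, is_pmf (W x).
Hypothesis acW : forall x y, W o y = 0 -> W x y = 0.
Variables (n M N : nat) (D : pred 'I_n) (g : 'I_N -> X) (gam t : R).
Hypotheses (N0 : (0 < N)%N) (gam0 : 0 < gam) (t0 : 0 <= t).
Local Notation word := {ffun 'I_n -> 'I_N}.
Local Notation book := {ffun 'I_M -> word}.

(** Likelihood ratio against the no-input law over the slots [D] of one user. A word consists of
    indices, turned into letters by [g], so that a uniform word has independent letters with the law
    pushed forward by [g]. *)
Definition density (c : word) (y : {ffun 'I_n -> Y}) : R :=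
  \prod_i (if D i then W (g (c i)) (y i) / W o (y i) else 1).

(** The default [w0] is reached only if every word, the sent one included, stays below the
    threshold, an event already counted as a missed detection. *)
Definition threshold_dec (w0 : 'I_M) (u : book) (y : {ffun 'I_n -> Y}) : 'I_M :=
  odflt w0 [pick w | gam <= density (u w) y].

Definition sent (x' : 'I_n -> X) (c : word) : {ffun 'I_n -> X} :=
  [ffun i => if D i then g (c i) else x' i].

(** The Chernoff factor of one slot: the mean of the likelihood ratio to the power [- t] under the
    law of the sent letter. *)
Definition miss_factor : R :=
  avg (fun a => \sum_y W (g a) y * expR (- t * ln (W (g a) y / W o y))).

(** The mean likelihood ratio of an independent letter; under absolute continuity it is 1 plus the
    chi-square of the averaged output law against the no-input law. *)
Definition false_factor : R :=
  \sum_y avg (fun a => W (g a) y) * avg (fun a => W (g a) y / W o y).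

Let W_ge0 x y : 0 <= W x y. Proof. exact: (pW x).1. Qed.

Lemma density_ge0 c y : 0 <= density c y.
Proof. by apply: prodr_ge0 => i _; case: ifP => // _; rewrite divr_ge0. Qed.

(** An error means that the sent word misses the threshold or that another word reaches it; Markov's
    inequality replaces the second indicator by [density / gam]. *)
Lemma threshold_dec_neq w0 u y w : (threshold_dec w0 u y != w)%:R <=
  (density (u w) y < gam)%R%:R + \sum_(w' | w' != w) density (u w') y / gam.
Proof.
have s0 (A : pred 'I_M) : 0 <= \sum_(w' | A w') density (u w') y / gam.
  by apply: sumr_ge0 => w' _; rewrite divr_ge0 ?density_ge0// ltW.
rewrite /threshold_dec; case: pickP => [w1 h1|/(_ w)/negbT] /=; last first.
  rewrite -ltNge => ->; apply: le_trans (_ : 1%:R <= _); last by rewrite lerDl.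
  by rewrite ler_nat leq_b1.
case: eqP => /= [_|/eqP w1w]; first by rewrite addr_ge0.
rewrite (bigD1 w1)//= addrCA; apply: le_trans (_ : density (u w1) y / gam <= _).
  by rewrite ler_pdivlMr// mul1r.
by rewrite lerDl addr_ge0//; exact: s0 (fun i => (i != w) && (i != w1)).
Qed.

(** On [density c y < gam] the factor (gam / density)^t is at least 1. It is spread over the letters
    so that the average over words factorises. Outputs of probability 0 are set apart because the
    logarithms add up only for positive ratios. *)
Lemma density_lt_le x' c y :
  chn W (sent x' c) y * (density c y < gam)%R%:R <=
  expR (t * ln gam) * \prod_i (if D i then
    W (g (c i)) (y i) * expR (- t * ln (W (g (c i)) (y i) / W o (y i)))
    else W (x' i) (y i)).
Proof.
have p0 (z : R) : 0 <= expR z by apply: expR_ge0.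
have rhs0 : 0 <= expR (t * ln gam) * \prod_i (if D i then
    W (g (c i)) (y i) * expR (- t * ln (W (g (c i)) (y i) / W o (y i)))
    else W (x' i) (y i)).
  rewrite mulr_ge0// prodr_ge0// => i _; case: ifP => // _.
  by rewrite mulr_ge0.
have [->|n0] := eqVneq (chn W (sent x' c) y) 0; first by rewrite mul0r.
case: ltP => [dlt|_]; last by rewrite mulr0.
rewrite mulr1.
pose l i : R := if D i then ln (W (g (c i)) (y i) / W o (y i)) else 0.
have rat i : D i -> 0 < W (g (c i)) (y i) / W o (y i).
  move=> Di; have := chn_neq0 i n0; rewrite ffunE Di => Wn.
  rewrite divr_gt0// lt_neqAle eq_sym W_ge0 andbT//.
  by apply: contraNneq Wn => /acW ->.
have dE : density c y = expR (\sum_i l i).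
  rewrite expR_sum; apply: eq_bigr => i _; rewrite /l.
  by case: ifP => [/rat h|_]; [rewrite lnK|rewrite expR0].
have -> : \prod_i (if D i then
    W (g (c i)) (y i) * expR (- t * ln (W (g (c i)) (y i) / W o (y i)))
    else W (x' i) (y i)) = chn W (sent x' c) y * expR (- t * \sum_i l i).
  rewrite mulr_sumr expR_sum -big_split/=; apply: eq_bigr => i _.
  by rewrite ffunE /l; case: ifP => //; rewrite mulr0 expR0 mulr1.
rewrite mulrCA ler_peMr//; first by apply: prodr_ge0.
rewrite -expRD -expR0 ler_expR mulNr -mulrBr mulr_ge0// subr_ge0.
by rewrite -ler_expR -dE lnK ?posrE// ltW.
Qed.

Lemma word_card_gt0 : (0 < #|[the finType of word]|)%N.
Proof. by rewrite card_ffun !card_ord expn_gt0 N0. Qed.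

Lemma prod_if_cst (a : R) : \prod_i (if D i then a else 1) = a ^+ #|D|.
Proof. by rewrite -big_mkcond/= prodr_const. Qed.

Lemma miss_prob x' :
  avg (fun c : word => \sum_y chn W (sent x' c) y * (density c y < gam)%R%:R) <=
  expR (t * ln gam) * miss_factor ^+ #|D|.
Proof.
pose G i a y := if D i then W (g a) y * expR (- t * ln (W (g a) y / W o y))
                else W (x' i) y.
apply: le_trans (_ : avg (fun c : word =>
    expR (t * ln gam) * \prod_i \sum_y G i (c i) y) <= _).
  apply: avg_le => c; rewrite -(sum_prod_ffun (fun i => G i (c i))) mulr_sumr.
  by apply: ler_sum => y _; apply: density_lt_le.
rewrite avgZ (avg_ffun_prod (fun i a => \sum_y G i a y)) -prod_if_cst.
rewrite le_eqVlt; apply/orP; left; apply/eqP; congr (_ * _).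
apply: eq_bigr => i _; rewrite /G; case: (D i) => //.
by rewrite (_ : (fun=> _) = fun=> 1) ?avg_cst ?card_ord//; apply/funext => a; apply: (pW _).2.
Qed.

Lemma false_prob x' :
  \sum_y avg (fun c : word => chn W (sent x' c) y) * avg (fun c => density c y) =
  false_factor ^+ #|D|.
Proof.
pose G i y := if D i then avg (fun a => W (g a) y) * avg (fun a => W (g a) y / W o y)
              else W (x' i) y.
transitivity (\sum_(y : {ffun 'I_n -> Y}) \prod_i G i (y i)).
  apply: eq_bigr => y _.
  rewrite (avg_ffun_prod (fun i a => if D i then W (g a) (y i) / W o (y i) else 1)).
  rewrite (_ : (fun c : word => chn W (sent x' c) y) = fun c : word =>
    \prod_i (if D i then W (g (c i)) (y i) else W (x' i) (y i))); last first.
    by apply/funext => c; apply: eq_bigr => i _; rewrite ffunE; case: ifP.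
  rewrite (avg_ffun_prod (fun i a => if D i then W (g a) (y i) else W (x' i) (y i))).
  rewrite -big_split/=; apply: eq_bigr => i _; rewrite /G; case: (D i) => //.
  by rewrite !avg_cst ?card_ord// mulr1.
rewrite (sum_prod_ffun G) -prod_if_cst; apply: eq_bigr => i _; rewrite /G.
by case: (D i) => //; apply: (pW _).2.
Qed.

(** The bound is uniform in [x'], since the decoder ignores the slots outside [D]; the other user's
    codebook can therefore be averaged afterwards. *)
Lemma random_code_error x' w0 w :
  avg (fun u : book => \sum_y chn W (sent x' (u w)) y * (threshold_dec w0 u y != w)%:R)
  <= expR (t * ln gam) * miss_factor ^+ #|D| + M%:R / gam * false_factor ^+ #|D|.
Proof.
have c0 c (y : {ffun 'I_n -> Y}) : 0 <= chn W (sent x' c) y by exact: prodr_ge0.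
pose F c := \sum_y chn W (sent x' c) y * (density c y < gam)%R%:R.
apply: le_trans (_ : avg (fun u : book => F (u w) + \sum_(w' | w' != w) gam^-1 *
    \sum_y chn W (sent x' (u w)) y * density (u w') y) <= _).
  apply: avg_le => u; rewrite -mulr_sumr exchange_big/= mulr_sumr -big_split/=.
  apply: ler_sum => y _.
  apply: le_trans (ler_wpM2l (c0 _ _) (threshold_dec_neq w0 u y w)) _.
  rewrite mulrDr lerD2l -mulr_suml mulrA mulrC -mulr_sumr//.
rewrite avgD lerD//.
  by rewrite (avg_ffun1 w F word_card_gt0); exact: miss_prob.
rewrite avg_sum.
have E w' : w' != w -> avg (fun u : book => gam^-1 *
    \sum_y chn W (sent x' (u w)) y * density (u w') y) =
    gam^-1 * false_factor ^+ #|D|.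
  move=> ww'; rewrite avgZ; congr (_ * _).
  rewrite (avg_sum (fun (u : book) y => chn W (sent x' (u w)) y * density (u w') y)).
  rewrite -(false_prob x'); apply: eq_bigr => y _.
  exact: (avg_ffun2 (fun c => chn W (sent x' c) y) (fun c => density c y)
    word_card_gt0 ww').
have f0 : 0 <= gam^-1 * false_factor ^+ #|D|.
  rewrite mulr_ge0 ?invr_ge0 ?(ltW gam0)// exprn_ge0// sumr_ge0// => y _.
  by rewrite mulr_ge0// mulr_ge0 ?invr_ge0 ?ler0n// sumr_ge0// => a _; rewrite divr_ge0.
apply: le_trans (_ : \sum_(w' : 'I_M) gam^-1 * false_factor ^+ #|D| <= _).
  rewrite (eq_bigr _ E) big_mkcond/=; apply: ler_sum => w' _.
  by case: ifP.
by rewrite sumr_const card_ord -(mulr_natl (_ * _)) mulrA.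
Qed.

End RandomCode.

Lemma avg_exchange (R : realType) (T C : finType) (F : T -> C -> R) :
  avg (fun t => avg (F t)) = avg (fun c => avg (F^~ c)).
Proof. by rewrite {1 3}/avg -!mulr_sumr exchange_big/= mulrCA. Qed.

(** * Covert broadcast codes keyed by their codebooks *)

Section CodeExists.
Variables (R : realType) (K : nat) (Y1 Y2 Z : finType).
Variable P : 'I_K.+1 -> Y1 -> Y2 -> Z -> R.
Hypothesis chP : is_channel P.
Hypothesis Q0_gt0 : forall z, 0 < chQ P ord0 z.
Hypothesis acW : forall x y1, chW P ord0 y1 = 0 -> chW P x y1 = 0.
Hypothesis acV : forall x y2, chV P ord0 y2 = 0 -> chV P x y2 = 0.

Lemma KL_product n (D : pred 'I_n) (q1 q2 q0 : Z -> R) :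
  is_pmf q1 -> is_pmf q2 -> is_pmf q0 -> (forall z, 0 < q0 z) ->
  KL (fun z : {ffun 'I_n -> Z} => \prod_i (if D i then q1 (z i) else q2 (z i)))
     (fun z => \prod_i q0 (z i)) =
  \sum_i (if D i then KL q1 q0 else KL q2 q0).
Proof.
move=> p1 p2 p0 q00.
(* The three laws are packed into one channel with inputs [Some true], [Some false] and [None], so
   that [sum_xlnx_chn] applies with [None] as reference. *)
pose V (b : option bool) := match b with
  | None => q0 | Some true => q1 | Some false => q2 end.
have pV b : is_pmf (V b) by case: b => [[]|].
pose x : {ffun 'I_n -> option bool} := [ffun i => Some (D i)].
pose x0 : {ffun 'I_n -> option bool} := [ffun=> None].
have := @sum_xlnx_chn R _ _ V n x x0 pV.
have -> : \sum_i KL (V (x i)) (V (x0 i)) = \sum_i (if D i then KL q1 q0 else KL q2 q0).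
  by apply: eq_bigr => i _; rewrite !ffunE /=; case: (D i).
move=> <-; last by move=> i z; rewrite ffunE /= => e; have := q00 z; rewrite e ltxx.
rewrite KLE; apply: eq_bigr => z _.
have -> : \prod_i (if D i then q1 (z i) else q2 (z i)) = chn V x z.
  by apply: eq_bigr => i _; rewrite ffunE /=; case: (D i).
have -> : \prod_i q0 (z i) = chn V x0 z.
  by apply: eq_bigr => i _; rewrite ffunE.
apply: mul_ln_div => [||_]; [exact: (chn_pmf x pV).1|exact: (chn_pmf x0 pV).1|].
by rewrite gt_eqF// prodr_gt0// => i _; rewrite ffunE.
Qed.

Lemma avg_pmf (T : finType) N (g : 'I_N -> 'I_K.+1) (V : 'I_K.+1 -> T -> R) :
  (0 < N)%N -> (forall x, is_pmf (V x)) -> is_pmf (fun t => avg (fun a => V (g a) t)).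
Proof.
move=> N0 pV; split=> [t|].
  rewrite mulr_ge0 ?invr_ge0 ?ler0n// sumr_ge0// => a _.
  exact: (pV _).1.
rewrite -avg_sum (_ : (fun=> _) = fun=> 1) ?avg_cst ?card_ord//.
by apply/funext => a; exact: (pV _).2.
Qed.

(** [err_prob] averages over the key, here the pair of codebooks, so the random-coding average is
    the error of this single code and no good codebook has to be selected. *)
Lemma random_code_exists n M1 M2 N1 N2 (D : pred 'I_n)
    (g1 : 'I_N1 -> 'I_K.+1) (g2 : 'I_N2 -> 'I_K.+1) (gam1 gam2 t1 t2 : R) :
  (0 < M1)%N -> (0 < M2)%N -> (0 < N1)%N -> (0 < N2)%N ->
  0 < gam1 -> 0 < gam2 -> 0 <= t1 -> 0 <= t2 ->
  exists c : code K Y1 Y2 n, [/\ cM1 c = M1, cM2 c = M2,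
    err_prob P c <=
      (expR (t1 * ln gam1) * miss_factor (chW P) ord0 g1 t1 ^+ #|D| +
       M1%:R / gam1 * false_factor (chW P) ord0 g1 ^+ #|D|) +
      (expR (t2 * ln gam2) * miss_factor (chV P) ord0 g2 t2 ^+ #|predC D| +
       M2%:R / gam2 * false_factor (chV P) ord0 g2 ^+ #|predC D|) &
    KL (@warden_out R K Y1 Y2 Z P n c) (@Q0n R K Y1 Y2 Z P n) =
      \sum_i (if D i then KL (fun z => avg (fun a => chQ P (g1 a) z)) (chQ P ord0)
              else KL (fun z => avg (fun a => chQ P (g2 a) z)) (chQ P ord0))].
Proof.
move=> M10 M20 N10 N20 gam10 gam20 t10 t20.
pose B1 : finType := {ffun 'I_M1 -> {ffun 'I_n -> 'I_N1}}.
pose B2 : finType := {ffun 'I_M2 -> {ffun 'I_n -> 'I_N2}}.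
have wc1 : (0 < #|{: {ffun 'I_n -> 'I_N1}}|)%N.
  by rewrite card_ffun !card_ord expn_gt0 N10.
have wc2 : (0 < #|{: {ffun 'I_n -> 'I_N2}}|)%N.
  by rewrite card_ffun !card_ord expn_gt0 N20.
have B10 : (0 < #|B1|)%N by rewrite card_ffun expn_gt0 wc1.
have B20 : (0 < #|B2|)%N by rewrite card_ffun expn_gt0 wc2.
pose key := (B1 * B2)%type.
have key0 : (0 < #|{: key}|)%N by rewrite card_prod muln_gt0 B10.
pose x w1 w2 (u : key) : {ffun 'I_n -> 'I_K.+1} :=
  [ffun i => if D i then g1 (u.1 w1 i) else g2 (u.2 w2 i)].
pose d1 y (u : key) :=
  threshold_dec (chW P) ord0 D g1 gam1 (Ordinal M10) u.1 y.
pose d2 y (u : key) :=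
  threshold_dec (chV P) ord0 (predC D) g2 gam2 (Ordinal M20) u.2 y.
pose c := @Code K Y1 Y2 n M1 M2 #|{: key}| M10 M20 key0
  (fun w1 w2 s => x w1 w2 (enum_val s)) (fun y s => d1 y (enum_val s))
  (fun y s => d2 y (enum_val s)).
have avg3K (F : 'I_M1 -> 'I_M2 -> key -> R) :
    avg3 (fun w1 w2 (s : 'I_#|{: key}|) => F w1 w2 (enum_val s)) =
    avg (fun w1 => avg (fun w2 => avg (fun u1 => avg (fun u2 => F w1 w2 (u1, u2))))).
  rewrite avg3_avg; congr avg; apply/funext => w1; congr avg; apply/funext => w2.
  by rewrite (avg_enum_val (F w1 w2)) avg_prod.
exists c; split=> //.
- apply: le_trans (err_prob_le chP c) _; apply: lerD.
    rewrite /err1 (avg3K (fun w1 w2 u => \sum_y chn (chW P) (x w1 w2 u) y *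
      (d1 y u != w1)%:R)).
    apply: avg_le_cst => [|w1]; first by rewrite card_ord.
    apply: avg_le_cst => [|w2]; first by rewrite card_ord.
    (* The codebook [u2] is averaged last: once it is fixed, its letters are a fixed background for
       user 1. *)
    rewrite avg_exchange; apply: avg_le_cst => // u2.
    exact: (random_code_error (chW_pmf chP) acW D g1 N10 gam10 t10
      (fun i => g2 (u2 w2 i)) (Ordinal M10) w1).
  rewrite /err2 (avg3K (fun w1 w2 u => \sum_y chn (chV P) (x w1 w2 u) y *
    (d2 y u != w2)%:R)).
  apply: avg_le_cst => [|w1]; first by rewrite card_ord.
  apply: avg_le_cst => [|w2]; first by rewrite card_ord.
  apply: avg_le_cst => // u1.
  have xE u2 : x w1 w2 (u1, u2) = sent (predC D) g2 (fun i => g1 (u1 w1 i)) (u2 w2).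
    by apply/ffunP => i; rewrite !ffunE /=; case: (D i).
  under [X in avg X]eq_fun do rewrite xE.
  exact: (random_code_error (chV_pmf chP) acV (predC D) g2 N20 gam20 t20
    (fun i => g1 (u1 w1 i)) (Ordinal M20) w2).
- have Qp := chQ_pmf chP.
  rewrite -KL_product//; [|exact: avg_pmf|exact: avg_pmf].
  congr KL; apply/funext => z; rewrite warden_outE.
  rewrite (avg3K (fun w1 w2 u => chn (chQ P) (x w1 w2 u) z)).
  (* Averaged over the codebooks, each pair of messages already gives the same product law, so the
     averages over messages act on a constant. *)
  rewrite -[RHS](@avg_cst R 'I_M1) ?card_ord//; congr avg; apply/funext => w1.
  rewrite -[RHS](@avg_cst R 'I_M2) ?card_ord//; congr avg; apply/funext => w2.
  pose H (c1 : {ffun 'I_n -> 'I_N1}) (c2 : {ffun 'I_n -> 'I_N2}) : R :=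
    \prod_i (if D i then chQ P (g1 (c1 i)) (z i) else chQ P (g2 (c2 i)) (z i)).
  transitivity (avg (fun u1 : B1 => avg (fun u2 : B2 => H (u1 w1) (u2 w2)))).
    congr avg; apply/funext => u1; congr avg; apply/funext => u2.
    by apply: eq_bigr => i _; rewrite ffunE; case: ifP.
  transitivity (avg (fun c1 => avg (fun c2 => H c1 c2))).
    rewrite -(avg_ffun1 w1 (fun c1 => avg (H c1)) wc1).
    congr avg; apply/funext => u1; exact: (avg_ffun1 w2 (H (u1 w1)) wc2).
  transitivity (avg (fun c1 : {ffun 'I_n -> 'I_N1} => \prod_i
      (if D i then chQ P (g1 (c1 i)) (z i) else avg (fun a => chQ P (g2 a) (z i))))).
    congr avg; apply/funext => c1.
    rewrite (avg_ffun_prod (fun i a => if D i then chQ P (g1 (c1 i)) (z i)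
      else chQ P (g2 a) (z i))); apply: eq_bigr => i _.
    by case: (D i) => //; rewrite avg_cst ?card_ord.
  rewrite (avg_ffun_prod (fun i a => if D i then chQ P (g1 a) (z i)
      else avg (fun a => chQ P (g2 a) (z i)))); apply: eq_bigr => i _.
  by case: (D i) => //; rewrite avg_cst ?card_ord.
Qed.

End CodeExists.

(** * Sparse input laws *)

Section OneLetter.
Variables (R : realType) (K : nat).
Implicit Types (T Z : finType) (v : 'I_K -> R).

(** The direction of perturbation: using letter [k] with probability [v k / r] moves the output law
    from [V ord0] to [V ord0 + r^-1 * tilt V v]. *)
Definition tilt T (V : 'I_K.+1 -> T -> R) v (y : T) : R :=
  \sum_(k < K) v k * (V (lift ord0 k) y - V ord0 y).

Definition tilt_chi2 T (V : 'I_K.+1 -> T -> R) v : R :=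
  \sum_y tilt V v y ^+ 2 / V ord0 y.

Lemma sum_tilt T (V : 'I_K.+1 -> T -> R) v : (forall x, is_pmf (V x)) ->
  \sum_y tilt V v y = 0.
Proof.
move=> pV; rewrite exchange_big/= big1// => k _.
by rewrite -mulr_sumr sumrB !(pV _).2 subrr mulr0.
Qed.

Lemma chi2_tilt T (V : 'I_K.+1 -> T -> R) (p : 'I_K -> R) (kap : R) : is_pmf p ->
  tilt_chi2 V (fun k => kap * p k) =
  kap ^+ 2 * chi2 (fun z => \sum_(k < K) p k * V (lift ord0 k) z) (V ord0).
Proof.
move=> pp; rewrite /tilt_chi2 /chi2 mulr_sumr; apply: eq_bigr => z _.
rewrite mulrA -exprMn; congr (_ ^+ 2 / _).
transitivity (kap * (\sum_(k < K) p k * V (lift ord0 k) z - (\sum_(k < K) p k) * V ord0 z)).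
  by rewrite mulr_suml -sumrB mulr_sumr; apply: eq_bigr => k _; ring.
by rewrite pp.2 mul1r.
Qed.

(** The linear term vanishes because [tilt] sums to 0, and [xlnx_quad_le] is applied with
    [a = H / r], a bound on the relative perturbation. *)
Lemma KL_tilt_le Z (Q : 'I_K.+1 -> Z -> R) v (q : Z -> R) (r H : R) :
  (forall x, is_pmf (Q x)) -> (forall z, 0 < Q ord0 z) ->
  0 < r -> 0 <= H < r ->
  (forall z, q z = Q ord0 z + r^-1 * tilt Q v z) ->
  (forall z, `|tilt Q v z / Q ord0 z| <= H) ->
  KL q (Q ord0) <= tilt_chi2 Q v / (2 * r * (r - H)).
Proof.
move=> pQ Q0 r0 /andP[H0 Hr] qE hH.
have rn : r != 0 by rewrite gt_eqF.
have Qn z : Q ord0 z != 0 by rewrite gt_eqF.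
pose a := H / r.
have a01 : 0 <= a < 1 by rewrite divr_ge0 ?(ltW r0)//= /a ltr_pdivrMr// mul1r.
pose y z := q z / Q ord0 z.
have yE z : y z - 1 = r^-1 * (tilt Q v z / Q ord0 z).
  by rewrite /y qE; field; rewrite rn Qn.
have ya z : 1 - a <= y z.
  suff : - (y z - 1) <= a by lra.
  rewrite yE; apply: le_trans (ler_norm _) _; rewrite normrN normrM.
  by rewrite ger0_norm ?invr_ge0 ?(ltW r0)// mulrC ler_wpM2r ?invr_ge0 ?(ltW r0).
have -> : KL q (Q ord0) = \sum_z Q ord0 z * (xlnx (y z) - (y z - 1)).
  rewrite KLE; transitivity (\sum_z (q z * ln (q z / Q ord0 z) - r^-1 * tilt Q v z)).
    by rewrite sumrB -mulr_sumr sum_tilt// mulr0 subr0.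
  apply: eq_bigr => z _; rewrite yE mulrBr; congr (_ - _); last by field; rewrite rn Qn.
  by rewrite /xlnx /y mulrA; congr (_ * _); field.
apply: le_trans (_ : \sum_z Q ord0 z * ((y z - 1) ^+ 2 / (2 * (1 - a))) <= _).
  apply: ler_sum => z _; apply: ler_wpM2l; first exact: ltW.
  exact: xlnx_quad_le.
rewrite /tilt_chi2 mulr_suml; apply: ler_sum => z _; rewrite yE.
rewrite le_eqVlt; apply/orP; left; apply/eqP; rewrite /a; field.
by rewrite rn Qn subr_eq0 gt_eqF.
Qed.

Lemma false_factor_tilt T (W : 'I_K.+1 -> T -> R) v N (g : 'I_N -> 'I_K.+1) (r : R) :
  (forall x, is_pmf (W x)) -> (forall x y, W ord0 y = 0 -> W x y = 0) -> r != 0 ->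
  (forall F : 'I_K.+1 -> R, avg (fun a => F (g a)) =
     F ord0 + r^-1 * \sum_(k < K) v k * (F (lift ord0 k) - F ord0)) ->
  false_factor W ord0 g = 1 + tilt_chi2 W v / r ^+ 2.
Proof.
move=> pW ac rn hg.
transitivity (\sum_y (W ord0 y + 2 / r * tilt W v y +
    tilt W v y ^+ 2 / W ord0 y / r ^+ 2)); last first.
  rewrite !big_split/= (pW ord0).2 -mulr_sumr sum_tilt// mulr0 addr0.
  by rewrite -mulr_suml.
apply: eq_bigr => y _.
have -> : avg (fun a => W (g a) y / W ord0 y) = avg (fun a => W (g a) y) / W ord0 y.
  by rewrite /avg -mulr_suml mulrA.
rewrite (hg (W^~ y)) -/(tilt W v y).
have [W0|Wn] := eqVneq (W ord0 y) 0; last by field; rewrite rn Wn.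
have -> : tilt W v y = 0.
  by rewrite /tilt big1// => k _; rewrite W0 ac// subrr mulr0.
by rewrite W0 invr0 !(mulr0, mul0r, addr0).
Qed.

Definition tilt_lin (D : 'I_K.+1 -> R) v : R := \sum_(k < K) v k * D (lift ord0 k).

Definition sq_logratio T (W : 'I_K.+1 -> T -> R) (x : 'I_K.+1) : R :=
  \sum_y W x y * ln (W x y / W ord0 y) ^+ 2.

(** Letter 0 contributes exactly 1. For the others [t * B <= 2^-1] makes [expR_le_quad] available,
    giving a gain [t] times the divergence against a loss quadratic in [t]; finally 1 + x <= e^x. *)
Lemma miss_factor_tilt T (W : 'I_K.+1 -> T -> R) v N (g : 'I_N -> 'I_K.+1) (r t B : R) :
  (forall x, is_pmf (W x)) -> (forall x y, W ord0 y = 0 -> W x y = 0) -> 0 < r ->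
  (forall k, 0 <= v k) ->
  (forall F : 'I_K.+1 -> R, avg (fun a => F (g a)) =
     F ord0 + r^-1 * \sum_(k < K) v k * (F (lift ord0 k) - F ord0)) ->
  0 <= t -> (forall x y, `|ln (W x y / W ord0 y)| <= B) -> t * B <= 2^-1 ->
  miss_factor W ord0 g t <= expR (- (r^-1 * (t * tilt_lin (fun x => KL (W x) (W ord0)) v
    - 2 * t ^+ 2 * tilt_lin (sq_logratio W) v))).
Proof.
move=> pW ac r0 v0 hg t0 hB tB.
pose rho x := \sum_y W x y * expR (- t * ln (W x y / W ord0 y)).
have rho0 : rho ord0 = 1.
  rewrite -[RHS](pW ord0).2; apply: eq_bigr => y _.
  have [->|Wn] := eqVneq (W ord0 y) 0; first by rewrite mul0r.
  by rewrite divff// ln1 mulr0 expR0 mulr1.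
have rho_le x : rho x <= 1 - t * KL (W x) (W ord0) + 2 * t ^+ 2 * sq_logratio W x.
  apply: le_trans (_ : \sum_y W x y * (1 + (- t * ln (W x y / W ord0 y)) +
      2 * (- t * ln (W x y / W ord0 y)) ^+ 2) <= _).
    apply: ler_sum => y _; apply: ler_wpM2l; first exact: (pW x).1.
    apply: expR_le_quad; apply: le_trans (ler_norm _) _.
    rewrite normrM normrN (ger0_norm t0); apply: le_trans tB.
    by rewrite ler_wpM2l.
  rewrite le_eqVlt; apply/orP; left; apply/eqP.
  transitivity (\sum_y W x y - t * KL (W x) (W ord0) + 2 * t ^+ 2 * sq_logratio W x).
    rewrite KLE /sq_logratio !mulr_sumr -sumrB -big_split/=.
    by apply: eq_bigr => y _; ring.
  by rewrite (pW x).2.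
rewrite /miss_factor (hg rho) rho0.
apply: le_trans (_ : 1 + - (r^-1 * (t * tilt_lin (fun x => KL (W x) (W ord0)) v
    - 2 * t ^+ 2 * tilt_lin (sq_logratio W) v)) <= _); last exact: expR_ge1Dx.
rewrite lerD2l -mulrN ler_pM2l ?invr_gt0// opprB.
rewrite /tilt_lin !mulr_sumr -sumrB; apply: ler_sum => k _.
have := ler_wpM2l (v0 k) (rho_le (lift ord0 k)); lra.
Qed.

Lemma sum_nth (s : seq 'I_K.+1) N (F : 'I_K.+1 -> R) : (size s <= N)%N ->
  \sum_(i < N) F (nth ord0 s i) = N%:R * F ord0 + \sum_(x <- s) (F x - F ord0).
Proof.
elim: s N => [|x s IH] N.
  move=> _; rewrite big_nil addr0 mulr_natl -[in RHS](card_ord N) -sumr_const.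
  by apply: eq_bigr => i _; rewrite nth_nil.
case: N => // N; rewrite ltnS => sN.
by rewrite big_ord_recl /= IH// big_cons -[N.+1%:R]natr1; ring.
Qed.

(** List [a k] copies of each nonzero letter; positions past the end of the list read the default of
    [nth], which is the no-input letter. *)
Lemma exists_letters (a : 'I_K -> nat) N : (\sum_k a k <= N)%N -> (0 < N)%N ->
  exists g : 'I_N -> 'I_K.+1, forall F : 'I_K.+1 -> R,
    avg (fun i => F (g i)) =
    F ord0 + N%:R^-1 * \sum_(k < K) (a k)%:R * (F (lift ord0 k) - F ord0).
Proof.
move=> aN N0; pose s := flatten [seq nseq (a k) (lift ord0 k) | k <- enum 'I_K].
have ss : size s = \sum_k a k.
  rewrite size_flatten sumnE /shape -map_comp big_map big_enum/=.
  by apply: eq_bigr => k _; rewrite /= size_nseq.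
exists (fun i => nth ord0 s i) => F.
rewrite /avg card_ord sum_nth ?ss// mulrDr mulKf ?pnatr_eq0 -?lt0n//; congr (_ + _ * _).
rewrite /s big_flatten/= big_map big_enum/=; apply: eq_bigr => k _.
rewrite big_nseq; elim: (a k) => [|m IH]; first by rewrite mul0r.
by rewrite iterS IH -[m.+1%:R]natr1; ring.
Qed.

End OneLetter.

(** * Asymptotics of the rounded sparse letter law *)

Section GoodLetters.
Variables (R : realType) (K : nat).

Lemma cvgn_sum (I : finType) (u : I -> nat -> R) (l : I -> R) :
  (forall i, u i n @[n --> \oo] --> l i) ->
  (\sum_i u i n) @[n --> \oo] --> \sum_i l i.
Proof. by move=> h; apply: cvg_big => //; exact: add_continuous. Qed.

Lemma near_expR_sqrt_le (u : nat -> R) (l eps : R) : l < 0 -> 0 < eps ->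
  u n @[n --> \oo] --> l ->
  \forall n \near \oo, expR (Num.sqrt n%:R * u n) <= eps.
Proof.
move=> l0 e0 ul; near=> n.
have un : u n <= l / 2 by near: n; apply: (cvgr_le _ ul); lra.
have sn : `|ln eps| / (- (l / 2)) <= Num.sqrt n%:R by near: n; exact: near_sqrt_ge.
have l2 : 0 < - (l / 2) by lra.
rewrite -[leRHS]lnK ?posrE// ler_expR.
have s0 : 0 <= Num.sqrt n%:R :> R by exact: sqrtr_ge0.
have h1 := ler_wpM2l s0 un.
move: sn; rewrite ler_pdivrMr// => h2.
have := ler_norm (- ln eps); rewrite normrN; lra.
Unshelve. all: by end_near. Qed.

Lemma cvg_invsqrt : (Num.sqrt n%:R)^-1 @[n --> \oo] --> (0 : R).
Proof.
apply/cvgrPdist_le => /= e e0; near=> n.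
have sn : e^-1 <= Num.sqrt n%:R by near: n; exact: near_sqrt_ge.
rewrite sub0r normrN ger0_norm ?invr_ge0 ?sqrtr_ge0//.
rewrite -[leRHS]invrK lef_pV2 ?posrE ?invr_gt0//.
by apply: lt_le_trans sn; rewrite invr_gt0.
Unshelve. all: by end_near. Qed.

Variables (p : 'I_K -> R) (kap : R).
Hypotheses (pp : is_pmf p) (kap0 : 0 < kap).

(** With an index set of size n, letter [k] gets probability [letter_count n k / n], that is
    [letter_weight n k / sqrt n]. Rounding down keeps the weights below [kap * p k]. *)
Definition letter_count n k : nat := Num.truncn (kap * p k * Num.sqrt n%:R).

Definition letter_weight n k : R := (letter_count n k)%:R / Num.sqrt n%:R.

Lemma letter_weight_ge0 n k : 0 <= letter_weight n k.
Proof. by rewrite divr_ge0 ?ler0n ?sqrtr_ge0. Qed.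

Lemma letter_count_itv n k :
  (letter_count n k)%:R <= kap * p k * Num.sqrt n%:R < (letter_count n k)%:R + 1.
Proof.
rewrite natr1; apply: truncn_itv.
by rewrite !mulr_ge0 ?(ltW kap0) ?sqrtr_ge0 ?pp.1.
Qed.

Lemma letter_weight_le n k : letter_weight n k <= kap * p k.
Proof.
have k0 : 0 <= kap * p k by rewrite mulr_ge0 ?(ltW kap0) ?pp.1.
have : 0 <= Num.sqrt n%:R :> R by exact: sqrtr_ge0.
rewrite le0r => /predU1P[e|s0]; first by rewrite /letter_weight e invr0 mulr0.
by rewrite /letter_weight ler_pdivrMr//; case/andP: (letter_count_itv n k).
Qed.

Lemma letter_weight_cvg k : letter_weight n k @[n --> \oo] --> kap * p k.
Proof.
apply: (squeeze_cvgr (f := fun n => kap * p k - (Num.sqrt n%:R)^-1)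
  (h := fun=> kap * p k)); last exact: cvg_cst.
  near=> n; rewrite letter_weight_le andbT.
  have s1 : 1 <= Num.sqrt n%:R :> R by near: n; exact: near_sqrt_ge.
  have s0 : 0 < Num.sqrt n%:R :> R by lra.
  rewrite /letter_weight ler_pdivlMr// mulrBl mulVf ?gt_eqF//.
  case/andP: (letter_count_itv n k); lra.
rewrite -[X in _ --> X]subr0; apply: cvgB; [exact: cvg_cst|exact: cvg_invsqrt].
Unshelve. all: by end_near. Qed.

Lemma near_letters : \forall n \near \oo, exists g : 'I_n -> 'I_K.+1,
  forall F : 'I_K.+1 -> R, avg (fun i => F (g i)) = F ord0 +
    (Num.sqrt n%:R)^-1 * \sum_(k < K) letter_weight n k * (F (lift ord0 k) - F ord0).
Proof.
near=> n.
have s1 : 1 <= Num.sqrt n%:R :> R by near: n; exact: near_sqrt_ge.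
have sk : kap <= Num.sqrt n%:R by near: n; exact: near_sqrt_ge.
have s0 : 0 < Num.sqrt n%:R :> R by lra.
have n0 : (0 < n)%N by move: s0; rewrite sqrtr_gt0 ltr0n.
have ss : Num.sqrt n%:R * Num.sqrt n%:R = n%:R :> R.
  by rewrite -expr2 sqr_sqrtr ?ler0n.
have aN : (\sum_k letter_count n k <= n)%N.
  rewrite -(ler_nat R) natr_sum.
  apply: le_trans (_ : \sum_k kap * p k * Num.sqrt n%:R <= _).
    by apply: ler_sum => k _; case/andP: (letter_count_itv n k).
  by rewrite -mulr_suml -mulr_sumr pp.2 mulr1 -[leRHS]ss ler_wpM2r// ltW.
have [g gE] := exists_letters R aN n0; exists g => F; rewrite gE.
have nV : n%:R^-1 = (Num.sqrt n%:R)^-1 * (Num.sqrt n%:R)^-1 :> R.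
  by rewrite -invfM ss.
congr (_ + _); rewrite nV -mulrA; congr (_ * _); rewrite mulr_sumr.
by apply: eq_bigr => k _; rewrite /letter_weight; ring.
Unshelve. all: by end_near. Qed.

Lemma tilt_chi2_cvg (T : finType) (V : 'I_K.+1 -> T -> R) :
  tilt_chi2 V (letter_weight n) @[n --> \oo] --> tilt_chi2 V (fun k => kap * p k).
Proof.
apply: cvgn_sum => y; apply: cvgM; last exact: cvg_cst.
have h : tilt V (letter_weight n) y @[n --> \oo] --> tilt V (fun k => kap * p k) y.
  by apply: cvgn_sum => k; apply: cvgM; [exact: letter_weight_cvg|exact: cvg_cst].
exact: (cvgM h h).
Qed.

Lemma tilt_lin_cvg (D : 'I_K.+1 -> R) :
  tilt_lin D (letter_weight n) @[n --> \oo] --> tilt_lin D (fun k => kap * p k).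
Proof.
by apply: cvgn_sum => k; apply: cvgM; [exact: letter_weight_cvg|exact: cvg_cst].
Qed.

Lemma near_KL_small (Z : finType) (Q : 'I_K.+1 -> Z -> R) (delta : R) :
  (forall x, is_pmf (Q x)) -> (forall z, 0 < Q ord0 z) -> 0 < delta ->
  kap ^+ 2 * chi2 (fun z => \sum_(k < K) p k * Q (lift ord0 k) z) (Q ord0) < 2 * delta ->
  \forall n \near \oo, forall q : Z -> R,
    (forall z, q z = Q ord0 z + (Num.sqrt n%:R)^-1 * tilt Q (letter_weight n) z) ->
    n%:R * KL q (Q ord0) <= delta.
Proof.
move=> pQ Q0 d0; rewrite -chi2_tilt//; set X := tilt_chi2 _ _ => Xd.
pose C := \sum_z (Q ord0 z)^-1.
have V0 z : 0 <= (Q ord0 z)^-1 by rewrite invr_ge0 ltW.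
have CV z : (Q ord0 z)^-1 <= C by rewrite /C (bigD1 z)//= lerDl sumr_ge0.
have C0 : 0 <= C by exact: sumr_ge0.
pose H := kap * C; have H0 : 0 <= H by rewrite mulr_ge0// ltW.
(* The strict room between [X] and [2 * delta] absorbs both the rounding of the weights and the
   factor [r / (r - H)] of [KL_tilt_le]. *)
pose mid := (X + 2 * delta) / 2.
have X0 : 0 <= X.
  by apply: sumr_ge0 => z _; rewrite divr_ge0 ?sqr_ge0// ltW.
have Xmid : X < mid by rewrite /mid; lra.
have near_mid := cvgr_le _ (@tilt_chi2_cvg Z Q) _ Xmid.
near=> n => q qE.
have Xn : tilt_chi2 Q (letter_weight n) <= mid.
  by near: n; exact: near_mid.
have s1 : 1 <= Num.sqrt n%:R :> R by near: n; exact: near_sqrt_ge.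
have s0 : 0 < Num.sqrt n%:R :> R by lra.
have sH : H + 1 <= Num.sqrt n%:R by near: n; exact: near_sqrt_ge.
(* Rearranged, this says [mid * r <= 2 * delta * (r - H)]. *)
have sm : H / (1 - mid / (2 * delta)) <= Num.sqrt n%:R by near: n; exact: near_sqrt_ge.
set r := Num.sqrt n%:R in s1 s0 sH sm qE *.
have rr : n%:R = r * r by rewrite -expr2 sqr_sqrtr ?ler0n.
have Hr : 0 <= H < r by rewrite H0/=; lra.
have tH z : `|tilt Q (letter_weight n) z / Q ord0 z| <= H.
  rewrite normrM (ger0_norm (V0 z)).
  apply: ler_pM => //; apply: le_trans (ler_norm_sum _ _ _) _.
  rewrite -[leRHS]mulr1 -pp.2 mulr_sumr; apply: ler_sum => k _.
  rewrite normrM (ger0_norm (letter_weight_ge0 _ _)) -[leRHS]mulr1.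
  apply: ler_pM => //; [exact: letter_weight_ge0|exact: letter_weight_le|].
  have le1 x : 0 <= Q x z <= 1.
    by rewrite (pQ x).1/= -(pQ x).2 (bigD1 z)//= lerDl sumr_ge0// => z' _; apply: (pQ x).1.
  rewrite ler_norml; have /andP[? ?] := le1 ord0.
  by have /andP[? ?] := le1 (lift ord0 k); apply/andP; split; lra.
have := KL_tilt_le pQ Q0 s0 Hr qE tH => h.
rewrite rr; apply: le_trans (ler_wpM2l (mulr_ge0 (ltW s0) (ltW s0)) h) _.
have rH : 0 < r - H by lra.
have -> : r * r * (tilt_chi2 Q (letter_weight n) / (2 * r * (r - H))) =
   tilt_chi2 Q (letter_weight n) * r / (2 * (r - H)).
  by field; rewrite !gt_eqF.
have m1 : 0 < 1 - mid / (2 * delta).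
  by rewrite subr_gt0 ltr_pdivrMr ?mulr_gt0// mul1r /mid; lra.
rewrite ler_pdivrMr ?mulr_gt0//.
apply: le_trans (_ : mid * r <= _); first by rewrite ler_wpM2r// ltW.
move: sm; rewrite ler_pdivrMr// mulrBr mulr1 => sm.
have e : r * (mid / (2 * delta)) * (2 * delta) = mid * r.
  by field; rewrite gt_eqF.
have d2 : 0 <= 2 * delta by lra.
have := ler_wpM2r d2 sm; rewrite [(r - _) * _]mulrBl e; lra.
Unshelve. all: by end_near. Qed.

(** Both error terms become [expR (sqrt n * u n)] up to a constant, with [u] tending to a negative
    limit; [u1] governs the missed detections and [u2] the false alarms. *)
Lemma good_letters (T Z : finType) (W : 'I_K.+1 -> T -> R) (Q : 'I_K.+1 -> Z -> R)
    (lam L delta eps : R) (mm : nat -> nat) :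
  (forall x, is_pmf (W x)) -> (forall x y, W ord0 y = 0 -> W x y = 0) ->
  (forall x, is_pmf (Q x)) -> (forall z, 0 < Q ord0 z) -> 0 < delta -> 0 < eps ->
  kap ^+ 2 * chi2 (fun z => \sum_(k < K) p k * Q (lift ord0 k) z) (Q ord0) < 2 * delta ->
  0 <= lam -> (forall n, (mm n <= n)%N) ->
  (mm n)%:R / n%:R @[n --> \oo] --> lam -> 0 <= L ->
  L * Num.sqrt delta <
    lam * kap * (\sum_(k < K) p k * KL (W (lift ord0 k)) (W ord0)) ->
  exists (t : R) (gam : nat -> R), [/\ 0 <= t, forall n, 0 < gam n &
    \forall n \near \oo, exists g : 'I_n -> 'I_K.+1,
      n%:R * KL (fun z => avg (fun a => Q (g a) z)) (Q ord0) <= delta /\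
      expR (t * ln (gam n)) * miss_factor W ord0 g t ^+ mm n +
      (Num.truncn (expR (L * Num.sqrt (n%:R * delta)))).+1%:R / gam n *
        false_factor W ord0 g ^+ mm n <= eps].
Proof.
move=> pW ac pQ Q0 d0 eps0 hkap lam0 mmn mml L0 hL.
set dp := \sum_(k < K) _ in hL.
have W0 x y : 0 <= W x y by exact: (pW x).1.
pose D x := KL (W x) (W ord0); pose E := sq_logratio W.
have DE : tilt_lin D (fun k => kap * p k) = kap * dp.
  by rewrite /tilt_lin mulr_sumr; apply: eq_bigr => k _; rewrite mulrA.
pose ep := tilt_lin E (fun k => kap * p k).
have ep0 : 0 <= ep.
  apply: sumr_ge0 => k _; rewrite mulr_ge0 ?mulr_ge0 ?(ltW kap0) ?pp.1//.
  by apply: sumr_ge0 => y _; rewrite mulr_ge0 ?sqr_ge0.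
(* The threshold exponent lies halfway between the rate demanded and the mean log-likelihood ratio,
   so both kinds of error have a margin. *)
pose G := (L * Num.sqrt delta + lam * kap * dp) / 2.
pose gap := lam * kap * dp - G.
have gap0 : 0 < gap by rewrite /gap /G; lra.
pose B := \sum_x \sum_y `|ln (W x y / W ord0 y)|.
have hB x y : `|ln (W x y / W ord0 y)| <= B.
  rewrite /B (bigD1 x)//= (bigD1 y)//= -addrA lerDl addr_ge0// ?sumr_ge0// => x' _.
  exact: sumr_ge0.
have B0 : 0 <= B by apply: sumr_ge0 => x _; exact: sumr_ge0.
(* The first bound serves [expR_le_quad]; the second makes the loss quadratic in [t] at most half of
   the gain [t * gap]. *)
pose t := Num.min (2 * (B + 1))^-1 (gap / (4 * (lam * ep + 1))).
have le0 : 0 <= lam * ep by rewrite mulr_ge0.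
have t0 : 0 < t by rewrite lt_min invr_gt0 !divr_gt0 ?mulr_gt0//; lra.
have tB : t * B <= 2^-1.
  apply: le_trans (_ : (2 * (B + 1))^-1 * B <= _).
    by rewrite ler_wpM2r// ge_min lexx.
  by rewrite mulrC ler_pdivrMr ?mulr_gt0//; lra.
have tE : t * (4 * (lam * ep + 1)) <= gap.
  by rewrite -ler_pdivlMr ?mulr_gt0//; [rewrite ge_min lexx orbT|lra].
pose gam n : R := expR (G * Num.sqrt n%:R).
exists t, gam; split; [exact: ltW|by move=> n; exact: expR_gt0|].
pose v := letter_weight.
pose u1 n := t * G - (mm n)%:R / n%:R *
  (t * tilt_lin D (v n) - 2 * t ^+ 2 * tilt_lin E (v n)).
pose l1 := t * G - lam * (t * (kap * dp) - 2 * t ^+ 2 * ep).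
have cu1 : u1 n @[n --> \oo] --> l1.
  apply: cvgB; first exact: cvg_cst.
  apply: cvgM; first exact: mml.
  rewrite -DE; apply: cvgB; apply: cvgM;
    by [exact: cvg_cst|exact: tilt_lin_cvg].
have l1n : l1 < 0.
  have -> : l1 = - t * (gap - 2 * t * (lam * ep)) by rewrite /l1 /gap; ring.
  rewrite mulNr oppr_lt0 mulr_gt0// subr_gt0.
  have := mulr_ge0 (ltW t0) le0; lra.
pose u2 n := L * Num.sqrt delta - G + tilt_chi2 W (v n) * (Num.sqrt n%:R)^-1.
pose l2 := L * Num.sqrt delta - G + tilt_chi2 W (fun k => kap * p k) * 0.
have cu2 : u2 n @[n --> \oo] --> l2.
  apply: cvgD; first exact: cvg_cst.
  by apply: cvgM; [exact: tilt_chi2_cvg|exact: cvg_invsqrt].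
have l2n : l2 < 0 by rewrite /l2 mulr0 addr0 /G; lra.
have e2 : 0 < eps / 2 by lra.
(* A quarter, because rounding the number of messages up costs a factor 2 in [M2]. *)
have e4 : 0 < eps / 4 by lra.
near=> n.
have [g gE] : exists g : 'I_n -> 'I_K.+1, forall F : 'I_K.+1 -> R,
    avg (fun i => F (g i)) = F ord0 + (Num.sqrt n%:R)^-1 *
      \sum_(k < K) v n k * (F (lift ord0 k) - F ord0).
  by near: n; exact: near_letters.
exists g; split.
  suff : forall q : Z -> R,
      (forall z, q z = Q ord0 z + (Num.sqrt n%:R)^-1 * tilt Q (letter_weight n) z) ->
      n%:R * KL q (Q ord0) <= delta.
    by apply => z; rewrite (gE (Q^~ z)).
  by near: n; exact: near_KL_small.
have s1 : 1 <= Num.sqrt n%:R :> R by near: n; exact: near_sqrt_ge.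
have s0 : 0 < Num.sqrt n%:R :> R by lra.
have b1 : expR (Num.sqrt n%:R * u1 n) <= eps / 2.
  by near: n; exact: near_expR_sqrt_le cu1.
have b2 : expR (Num.sqrt n%:R * u2 n) <= eps / 4.
  by near: n; exact: near_expR_sqrt_le cu2.
set r := Num.sqrt n%:R in s1 s0 b1 b2 gE *.
have rn : r != 0 by rewrite gt_eqF.
have rr : n%:R = r ^+ 2 by rewrite sqr_sqrtr ?ler0n.
have nn : n%:R != 0 :> R by rewrite rr expf_neq0.
have v0 k : 0 <= v n k by exact: letter_weight_ge0.
have part1 : expR (t * ln (gam n)) * miss_factor W ord0 g t ^+ mm n <= eps / 2.
  apply: le_trans b1; rewrite /gam expRK -/r.
  have mf0 : 0 <= miss_factor W ord0 g t.
    rewrite mulr_ge0 ?invr_ge0 ?ler0n// sumr_ge0// => a _; rewrite sumr_ge0// => y _.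
    by rewrite mulr_ge0 ?expR_ge0.
  have := miss_factor_tilt pW ac s0 v0 gE (ltW t0) hB tB.
  rewrite -/D -/E; set z := r^-1 * _ => mf.
  apply: le_trans (_ : expR (t * (G * r)) * expR (- z) ^+ mm n <= _).
    by rewrite ler_wpM2l ?expR_ge0// lerXn2r// ?nnegrE ?expR_ge0.
  rewrite -expRM_natl -expRD ler_expR le_eqVlt; apply/orP; left; apply/eqP.
  by rewrite /u1 /z rr; field.
have part2 : (Num.truncn (expR (L * Num.sqrt (n%:R * delta)))).+1%:R / gam n *
    false_factor W ord0 g ^+ mm n <= eps / 2.
  set M := _.+1.
  have M2 : M%:R <= 2 * expR (L * Num.sqrt delta * r).
    have e1 : 1 <= expR (L * Num.sqrt delta * r).
      by rewrite -expR0 ler_expR !mulr_ge0 ?sqrtr_ge0.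
    have E1 : L * Num.sqrt (n%:R * delta) = L * Num.sqrt delta * r.
      by rewrite sqrtrM ?ler0n// -/r; ring.
    rewrite /M E1 -natr1.
    have := truncn_itv (expR_ge0 (L * Num.sqrt delta * r)) => /andP[h _].
    lra.
  rewrite (false_factor_tilt pW ac rn gE).
  set X := tilt_chi2 W (v n).
  have X0 : 0 <= X by apply: sumr_ge0 => y _; rewrite divr_ge0 ?sqr_ge0.
  (* At most n factors, each [1 + X / n]: the second moment stays bounded, so false alarms cost no
     exponent. *)
  have fX : (1 + X / r ^+ 2) ^+ mm n <= expR X.
    apply: le_trans (_ : expR (X / r ^+ 2) ^+ mm n <= _).
      rewrite lerXn2r ?nnegrE ?expR_ge0 ?expR_ge1Dx//.
      by rewrite addr_ge0// divr_ge0 ?sqr_ge0.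
    rewrite -expRM_natl ler_expR -rr mulrCA -[leRHS]mulr1 ler_wpM2l//.
    have np : 0 < n%:R :> R by rewrite rr exprn_gt0.
    by rewrite ler_pdivrMr// mul1r ler_nat.
  have g0 : 0 < (gam n)^-1 by rewrite invr_gt0 expR_gt0.
  apply: le_trans (_ : 2 * expR (L * Num.sqrt delta * r) / gam n * expR X <= _).
    apply: ler_pM => //.
    - by rewrite mulr_ge0 ?ler0n ?(ltW g0).
    - by rewrite exprn_ge0// addr_ge0// divr_ge0 ?sqr_ge0.
    - by rewrite ler_wpM2r// ltW.
  have -> : 2 * expR (L * Num.sqrt delta * r) / gam n * expR X = 2 * expR (r * u2 n).
    rewrite /gam -/r -expRN; transitivity (2 * expR (L * Num.sqrt delta * r - G * r + X)).
      by rewrite !expRD; ring.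
    by congr (_ * expR _); rewrite /u2 -/X -/r; field.
  by lra.
by lra.
Unshelve. all: by end_near. Qed.

End GoodLetters.

(** * Achievability of the interior *)

Section Achievability.
Variables (R : realType) (K : nat) (Y1 Y2 Z : finType).
Variable P : 'I_K.+1 -> Y1 -> Y2 -> Z -> R.
Hypothesis chP : is_channel P.
Hypothesis Q0_gt0 : forall z, 0 < chQ P ord0 z.
Hypothesis nonred : ~ (exists p : 'I_K -> R, is_pmf p /\
  forall z, chQ P ord0 z = \sum_(k < K) p k * chQ P (lift ord0 k) z).

Lemma KL_ge0 (T : finType) (p q : T -> R) : is_pmf p -> is_pmf q ->
  (forall t, q t = 0 -> p t = 0) -> 0 <= KL p q.
Proof.
move=> pp pq ac.
have n0 t : p t != 0 -> q t != 0 by apply: contraNneq => /ac ->.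
rewrite KLE (eq_bigr (fun t => xlnx (p t) - p t * ln (q t))) => [|t _]; last first.
  by apply: mul_ln_div; [exact: pp.1|exact: pq.1|exact: n0].
by rewrite sumrB subr_ge0 gibbs ?pp.2 ?pq.2//; [exact: pp.1|exact: pq.1].
Qed.

(** The warden requires [kap] below sqrt(2 delta / chi2), the rate requires it above (L / lam)
    sqrt(delta) / D. This interval is nonempty because [p] is chosen with a value in [Lstar] above
    [L / lam]; [kap] is its midpoint. *)
Lemma exists_tilt (T : finType) (V : 'I_K.+1 -> T -> R) (L lam delta : R) :
  (forall x, is_pmf (V x)) -> (forall x y, V ord0 y = 0 -> V x y = 0) ->
  0 < Lstar V (chQ P) -> 0 <= L -> 0 < lam -> 0 < delta ->
  L < lam * Lstar V (chQ P) ->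
  exists (p : 'I_K -> R) (kap : R), [/\ is_pmf p, 0 < kap,
    kap ^+ 2 * chi2 (fun z => \sum_(k < K) p k * chQ P (lift ord0 k) z) (chQ P ord0)
      < 2 * delta &
    L * Num.sqrt delta <
      lam * kap * (\sum_(k < K) p k * KL (V (lift ord0 k)) (V ord0))].
Proof.
move=> pV ac Ls0 L0 lam0 d0 hL.
pose l := L / lam.
have l0 : 0 <= l by rewrite divr_ge0// ltW.
have lL : l < Lstar V (chQ P) by rewrite /l ltr_pdivrMr// mulrC.
have e0 : 0 < Lstar V (chQ P) - l by rewrite subr_gt0.
have [_ [p [pp ->]]] := sup_adherent e0 (Lstar_has_sup Ls0).
rewrite -/(Lstar V (chQ P)) opprB addrC subrK => hv.
have c0 := chi2_gt0 Q0_gt0 nonred pp.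
set c := chi2 _ _ in c0 hv *; set D := \sum_(k < K) _ in hv *.
have D0 : 0 <= D.
  apply: sumr_ge0 => k _; rewrite mulr_ge0 ?pp.1// KL_ge0// => y; exact: ac.
have Dp : 0 < D.
  rewrite lt_neqAle D0 andbT; apply/negP => /eqP De.
  by move: hv; rewrite -De expr0n/= mulr0 mul0r sqrtr0 ltNge l0.
pose k1 := Num.sqrt (2 * delta / c).
have k1p : 0 < k1 by rewrite sqrtr_gt0 divr_gt0 ?mulr_gt0.
have sd : 0 < Num.sqrt delta by rewrite sqrtr_gt0.
have lk : l * Num.sqrt delta / D < k1.
  rewrite ltr_pdivrMr//.
  have -> : k1 * D = Num.sqrt (2 * D ^+ 2 / c) * Num.sqrt delta.
    rewrite -[in LHS](ger0_norm D0) -sqrtr_sqr /k1 -!sqrtrM.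
    - by congr Num.sqrt; ring.
    - by rewrite divr_ge0 ?mulr_ge0 ?sqr_ge0// ltW.
    - by rewrite divr_ge0 ?mulr_ge0// ltW.
  by rewrite ltr_pM2r.
have lk0 : 0 <= l * Num.sqrt delta / D.
  by apply: divr_ge0 => //; apply: mulr_ge0 => //; exact: ltW.
pose kap := (l * Num.sqrt delta / D + k1) / 2.
have kap0 : 0 < kap by rewrite /kap; lra.
exists p, kap; split=> //.
  rewrite -ltr_pdivlMr//.
  have dc0 : 0 <= 2 * delta / c by rewrite divr_ge0 ?mulr_ge0 ?(ltW d0) ?(ltW c0).
  rewrite -(sqr_sqrtr dc0) ltr_sqr ?nnegrE ?(ltW kap0) ?sqrtr_ge0//.
  by rewrite -/k1 /kap; lra.
have ll : lam * l = L by rewrite /l mulrC divfK// gt_eqF.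
have : l * Num.sqrt delta < kap * D by rewrite -ltr_pdivrMr// /kap; lra.
move=> h; rewrite -ll -/D -[ltLHS](mulrA lam l) -[ltRHS](mulrA lam kap).
by rewrite ltr_pM2l.
Qed.

(** Covertness is demanded at every n; this code fills the lengths at which the asymptotic
    construction gives nothing. *)
Lemma trivial_code n : exists c : code K Y1 Y2 n,
  KL (@warden_out R K Y1 Y2 Z P n c) (@Q0n R K Y1 Y2 Z P n) = 0.
Proof.
exists (@Code K Y1 Y2 n 1 1 1 isT isT isT (fun _ _ _ => [ffun=> ord0])
  (fun _ _ => ord0) (fun _ _ => ord0)).
rewrite warden_outE Q0nE (_ : (fun z => _) = chn (chQ P) [ffun=> ord0]) ?KLxx//.
by apply/funext => z; rewrite /avg3 !big_ord1 /= invr1 mul1r.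
Qed.

Lemma truncn_ratio_cvg (lam : R) : 0 <= lam ->
  (Num.truncn (lam * n%:R))%:R / n%:R @[n --> \oo] --> lam.
Proof.
move=> lam0; apply/cvgrPdist_le => /= e e0; near=> n.
have n1 : 1 <= n%:R :> R by near: n; exact: nbhs_infty_ger.
have ne : e^-1 <= n%:R :> R by near: n; exact: nbhs_infty_ger.
have n0 : 0 < n%:R :> R by lra.
have /andP[h1 h2] := truncn_itv (mulr_ge0 lam0 (ltW n0)).
rewrite -natr1 in h2.
have ie : 1 <= e * n%:R by rewrite -ler_pdivrMl// mulr1.
rewrite ger0_norm ?subr_ge0; last by rewrite ler_pdivrMr.
by rewrite lerBlDr -lerBlDl ler_pdivlMr// mulrBl; lra.
Unshelve. all: by end_near. Qed.

Lemma card_ltn_ord n m : (m <= n)%N -> #|[pred i : 'I_n | (i < m)%N]| = m.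
Proof.
move=> mn; rewrite -sum1_card -[RHS]card_ord -sum1_card.
by rewrite (big_ord_widen n (fun=> 1%N) mn).
Qed.

Hypothesis acW : forall (k : 'I_K) y1, chW P ord0 y1 = 0 -> chW P (lift ord0 k) y1 = 0.
Hypothesis acV : forall (k : 'I_K) y2, chV P ord0 y2 = 0 -> chV P (lift ord0 k) y2 = 0.
Local Notation L1s := (Lstar (chW P) (chQ P)).
Local Notation L2s := (Lstar (chV P) (chQ P)).
Hypotheses (L1_gt0 : 0 < L1s) (L2_gt0 : 0 < L2s).

Lemma achievable_interior (eps delta : R) (L : R * R) : 0 < eps -> 0 < delta ->
  0 <= L.1 -> 0 <= L.2 -> L.1 / L1s + L.2 / L2s < 1 -> achievable P eps delta L.
Proof.
move=> eps0 d0 L10 L20 hL.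
have Wp := chW_pmf chP; have Vp := chV_pmf chP; have Qp := chQ_pmf chP.
have aW := abscont_all acW; have aV := abscont_all acV.
pose sig := 1 - (L.1 / L1s + L.2 / L2s).
have sig0 : 0 < sig by rewrite subr_gt0.
have q1 : 0 <= L.1 / L1s by rewrite divr_ge0// ltW.
have q2 : 0 <= L.2 / L2s by rewrite divr_ge0// ltW.
(* The slack [sig] is shared equally, so both users operate strictly below their share of the
   capacity. *)
pose lam := L.1 / L1s + sig / 2.
have lam0 : 0 < lam by rewrite /lam; lra.
have lam1 : 0 < 1 - lam by rewrite /lam /sig; lra.
have hL1 : L.1 < lam * L1s.
  by rewrite -ltr_pdivrMr// /lam; lra.
have hL2 : L.2 < (1 - lam) * L2s.
  by rewrite -ltr_pdivrMr// /lam /sig; lra.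
have [p1 [kap1 [pp1 k10 kd1 kL1]]] := exists_tilt Wp aW L1_gt0 L10 lam0 d0 hL1.
have [p2 [kap2 [pp2 k20 kd2 kL2]]] := exists_tilt Vp aV L2_gt0 L20 lam1 d0 hL2.
pose mm n := Num.truncn (lam * n%:R).
have mmn n : (mm n <= n)%N.
  rewrite -(ler_nat R); apply: le_trans (_ : lam * n%:R <= _).
    by rewrite truncn_le mulr_ge0 ?ler0n// ltW.
  by rewrite ler_piMl ?ler0n//; lra.
have mc : (mm n)%:R / n%:R @[n --> \oo] --> lam by exact: truncn_ratio_cvg (ltW lam0).
have mc' : (n - mm n)%:R / n%:R @[n --> \oo] --> 1 - lam.
  have : 1 - (mm n)%:R / n%:R @[n --> \oo] --> 1 - lam.
    by apply: cvgB => //; exact: cvg_cst.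
  apply: cvg_trans; apply: near_eq_cvg; near=> n.
  have n0 : (0 < n)%N by near: n; exact: nbhs_infty_gt.
  by rewrite natrB// mulrBl divff// pnatr_eq0 -lt0n.
have e2 : 0 < eps / 2 by lra.
have [t1 [gam1 [t10 g10 near1]]] := good_letters pp1 k10 Wp aW Qp Q0_gt0 d0 e2 kd1
  (ltW lam0) mmn mc L10 kL1.
have [t2 [gam2 [t20 g20 near2]]] := good_letters pp2 k20 Vp aV Qp Q0_gt0 d0 e2 kd2
  (ltW lam1) (fun n => leq_subr (mm n) n) mc' L20 kL2.
(* The successor makes [ln (M l n)] at least [l * sqrt (n * delta)]. *)
pose M (l : R) n := (Num.truncn (expR (l * Num.sqrt (n%:R * delta)))).+1.
pose good n (c : code K Y1 Y2 n) :=
  [/\ KL (@warden_out R K Y1 Y2 Z P n c) (@Q0n R K Y1 Y2 Z P n) <= delta,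
      cM1 c = M L.1 n, cM2 c = M L.2 n & err_prob P c <= eps].
have near_good : \forall n \near \oo, exists c : code K Y1 Y2 n, good n c.
  near=> n.
  have n0 : (0 < n)%N by near: n; exact: nbhs_infty_gt.
  have np : 0 < n%:R :> R by rewrite ltr0n.
  have [|g1 [KL1 er1]] := near near1 n; first by [].
  have [|g2 [KL2 er2]] := near near2 n; first by [].
  pose D := [pred i : 'I_n | (i < mm n)%N].
  have cD : #|D| = mm n by exact: card_ltn_ord.
  have cD' : #|predC D| = (n - mm n)%N.
    by rewrite -[X in (X - _)%N](card_ord n) -(cardC D) cD addKn.
  have [c [c1 c2 cerr cKL]] := random_code_exists chP Q0_gt0 aW aV
    (M1 := M L.1 n) (M2 := M L.2 n) D g1 g2
    isT isT n0 n0 (g10 n) (g20 n) t10 t20.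
  exists c; split=> //.
    (* Each slot spends at most [delta / n], whichever user's letter law it carries. *)
    rewrite cKL; apply: le_trans (_ : \sum_(i < n) delta / n%:R <= _).
      apply: ler_sum => i _; rewrite ler_pdivlMr// mulrC.
      by case: ifP.
    by rewrite sumr_const card_ord -(mulr_natl (_ / _)) mulrC divfK// gt_eqF.
  rewrite -/(M L.1 n) in er1; rewrite -/(M L.2 n) in er2.
  apply: le_trans cerr _; rewrite cD cD' [leRHS]splitr.
  exact: (lerD er1 er2).
(* One sequence that is covert at every n and good whenever a good code exists, hence eventually. *)
have code_n n : exists c : code K Y1 Y2 n,
    KL (@warden_out R K Y1 Y2 Z P n c) (@Q0n R K Y1 Y2 Z P n) <= delta /\
    ((exists c' : code K Y1 Y2 n, good n c') -> good n c).
  have [[c gc]|ng] := pselect (exists c' : code K Y1 Y2 n, good n c').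
    by exists c; split=> //; case: gc.
  by have [c cKL] := trivial_code n; exists c; rewrite cKL ltW.
pose c n := sval (cid (code_n n)); have hc n := svalP (cid (code_n n)).
split=> //; split=> //; exists c; split; first by move=> n; case: (hc n).
have lnM l n : 0 <= l -> (0 < n)%N ->
    l <= ln (M l n)%:R / Num.sqrt (n%:R * delta).
  move=> l0 n0; have s0 : 0 < Num.sqrt (n%:R * delta).
    by rewrite sqrtr_gt0 mulr_gt0 ?ltr0n.
  rewrite ler_pdivlMr// -[leLHS]expRK ler_ln ?posrE ?expR_gt0 ?ltr0n//.
  by have /andP[_ /ltW] := truncn_itv (expR_ge0 (l * Num.sqrt (n%:R * delta))).
split; [|split].
- apply: limn_einf_ge_of_near; near=> n.
  have n0 : (0 < n)%N by near: n; exact: nbhs_infty_gt.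
  have [_ h] := hc n; have [//|_ -> _ _] := h _; last exact: lnM.
  by near: n.
- apply: limn_einf_ge_of_near; near=> n.
  have n0 : (0 < n)%N by near: n; exact: nbhs_infty_gt.
  have [_ h] := hc n; have [//|_ _ -> _] := h _; last exact: lnM.
  by near: n.
- apply: limn_esup_le_of_near; near=> n.
  have [_ h] := hc n; have [//|_ _ _ //] := h _.
  by near: n.
Unshelve. all: by end_near. Qed.

(** [achievable_interior] needs a strict inequality; boundary points are limits of [rho * L] as
    [rho] tends to 1 from below. *)
Lemma region_supset (delta : R) (L : R * R) : 0 < delta ->
  0 <= L.1 -> 0 <= L.2 -> L.1 / L1s + L.2 / L2s <= 1 ->
  covert_capacity_region P delta L.
Proof.
move=> d0 L10 L20 hL eps /andP[eps0 _] B BL.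
have cL : (fun rho : R => (rho * L.1, rho * L.2)) @ (1 : R)^'- --> L.
  have c1 (l : R) : (fun rho : R => rho * l) @ (1 : R)^'- --> l.
    rewrite -[X in _ --> X]mul1r; apply: cvgM; last exact: cvg_cst.
    exact: cvg_within.
  case: L {L10 L20 hL BL} => l1 l2.
  exact: (cvg_pair (c1 l1) (c1 l2)).
near (1 : R)^'- => rho.
have rho1 : rho < 1 by near: rho; exact: nbhs_left_lt.
have rho0 : 0 < rho by near: rho; exact: nbhs_left_gt.
exists (rho * L.1, rho * L.2); split; last by near: rho; exact: cL.
apply: achievable_interior => //=; rewrite ?mulr_ge0// ?(ltW rho0)//.
have -> : rho * L.1 / L1s + rho * L.2 / L2s = rho * (L.1 / L1s + L.2 / L2s) by ring.
have S0 : 0 <= L.1 / L1s + L.2 / L2s by rewrite addr_ge0 ?divr_ge0 ?(ltW L1_gt0) ?(ltW L2_gt0).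
by apply: le_lt_trans rho1; rewrite -[leRHS]mulr1 ler_wpM2l// ltW.
Unshelve. all: by end_near. Qed.

End Achievability.

Theorem theorem2 (R : realType) (K : nat) (Y1 Y2 Z : finType)
    (P : 'I_K.+1 -> Y1 -> Y2 -> Z -> R) :
  is_channel P ->
  (* supp(Q_0) = Z *)
  (forall z, 0 < chQ P ord0 z) ->
  (* 0 is not redundant: Q_0 not in conv{Q_x' : x' <> 0} *)
  ~ (exists p : 'I_K -> R, is_pmf p /\
       forall z, chQ P ord0 z = \sum_(k < K) p k * chQ P (lift ord0 k) z) ->
  (* W(.|k) << W(.|0) and V(.|k) << V(.|0) *)
  (forall (k : 'I_K) y1, chW P ord0 y1 = 0 -> chW P (lift ord0 k) y1 = 0) ->
  (forall (k : 'I_K) y2, chV P ord0 y2 = 0 -> chV P (lift ord0 k) y2 = 0) ->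
  (* L1*, L2* > 0 (implicit in the paper: needed for L_j / L_j^* ) *)
  0 < Lstar (chW P) (chQ P) ->
  0 < Lstar (chV P) (chQ P) ->
  (* the ratio condition, max_{P_X} I1/I2 <= L1*/L2* (resp. symmetric),
     written in cross-multiplied form *)
  (if Lstar (chV P) (chQ P) <= Lstar (chW P) (chQ P) then
     forall PX : 'I_K.+1 -> R, is_pmf PX ->
       MI PX (chW P) * Lstar (chV P) (chQ P) <= Lstar (chW P) (chQ P) * MI PX (chV P)
   else
     forall PX : 'I_K.+1 -> R, is_pmf PX ->
       MI PX (chV P) * Lstar (chW P) (chQ P) <= Lstar (chV P) (chQ P) * MI PX (chW P)) ->
  forall delta : R, 0 < delta ->
    covert_capacity_region P delta =
    [set L : R * R | 0 <= L.1 /\ 0 <= L.2 /\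
       L.1 / Lstar (chW P) (chQ P) + L.2 / Lstar (chV P) (chQ P) <= 1].
Proof.
move=> chP Q0 nonred acW acV L1 L2 hMI delta d0; apply/seteqP; split=> L.
  exact: (region_subset chP Q0 nonred acW acV L1 L2 hMI d0).
by move=> [L10 [L20 hL]]; exact: (region_supset chP Q0 nonred acW acV L1 L2 d0).
Qed.
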